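(* Let $C$ be the group with generators $u_1,\dots,u_{27}$ and relations (R1)–(R4) below, and let $\psi_C\colon C\to S_{18}$ be the homomorphism sending $u_j$ to the transposition $(\alpha\,\beta)$, where $\{\alpha,\beta\}$ is the pair of endpoints of edge $j$ of $T$. Then: (i) $\psi_C$ is surjective. The subgroup $\langle u_j : j\in T_0\rangle$, where $T_0=\{5,6,8,9,11,12,14,16,18,19,20,21,22,24,25,26,27\}$ is a spanning tree of $T$, is mapped isomorphically onto $S_{18}$ by $\psi_C$. Hence $C=S_{18}\ltimes K_C$ with $K_C=\ker\psi_C$. (ii) Let $H$ be the group generated by $x_1,\dots,x_{18},y_1,\dots,y_{18},z$ with relations $[x_i,x_j]=[y_i,y_j]=[x_i,y_j]=1$ for all $i\neq j$, $[x_i,y_i]=z$ for all $i$, and $z$ central. Let $\mathrm{ab}\colon H\to\mathbb{Z}^2=\langle x\rangle\times\langle y\rangle$ be given by $x_i\mapsto x$, $y_i\mapsto y$, $z\mapsto 1$. Then $K_C\cong\ker(\mathrm{ab})$. Moreover $C\cong S_{18}\ltimes\ker(\mathrm{ab})$, where $\sigma\in S_{18}$ acts by $x_i\mapsto x_{\sigma(i)}$, $y_i\mapsto y_{\sigma(i)}$, $z\mapsto z$, and under this isomorphism $\psi_C$ corresponds to the projection onto $S_{18}$. (iii) In particular, $K_C$ is a central extension of $\mathbb{Z}^{34}$ by $\mathbb{Z}=\langle z\rangle$, and the center of $C$ is the infinite cyclic group $\langle z\rangle$.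
   Context: Let $T$ be the graph with vertex set $\{1,\dots,18\}$ and 27 edges labelled $1,\dots,27$. Edge $j$ joins the two vertices listed after it: 1:$\{2,7\}$, 2:$\{1,13\}$, 3:$\{4,9\}$, 4:$\{1,3\}$, 5:$\{1,5\}$, 6:$\{2,3\}$, 7:$\{2,6\}$, 8:$\{3,10\}$, 9:$\{4,6\}$, 10:$\{4,5\}$, 11:$\{5,8\}$, 12:$\{6,14\}$, 13:$\{7,15\}$, 14:$\{7,11\}$, 15:$\{8,12\}$, 16:$\{8,16\}$, 17:$\{9,11\}$, 18:$\{9,17\}$, 19:$\{10,12\}$, 20:$\{10,18\}$, 21:$\{11,12\}$, 22:$\{13,15\}$, 23:$\{13,17\}$, 24:$\{14,18\}$, 25:$\{14,16\}$, 26:$\{15,16\}$, 27:$\{17,18\}$. (Geometrically, the vertices of $T$ are the 18 planes and the edges are the 27 intersection lines of a degeneration of $\mathbb{T}\times\mathbb{T}$, for $\mathbb{T}$ a complex torus, into a union of planes. This triangulates a torus with 9 vertices $V_1,\dots,V_9$, each lying on 6 lines.) Nine hexagons in $T$ are given by ordered 6-tuples of edges $(a_r,b_r,c_r,d_r,e_r,f_r)$, $r=1,\dots,9$: $V_1$: $(2,4,6,1,13,22)$; $V_2$: $(1,7,9,3,17,14)$; $V_3$: $(3,10,5,2,23,18)$; $V_4$: $(11,15,19,8,4,5)$; $V_5$: $(8,20,24,12,7,6)$; $V_6$: $(12,25,16,11,10,9)$; $V_7$: $(26,13,14,21,15,16)$; $V_8$: $(21,17,18,27,20,19)$; $V_9$: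 $(27,23,22,26,25,24)$. In each tuple, cyclically consecutive edges share an endpoint, so the six edges form a 6-cycle in $T$. The group $C$ is generated by $u_1,\dots,u_{27}$ with the relations: (R1) $u_j^2=1$ for all $j$; (R2) $u_iu_j=u_ju_i$ whenever edges $i$ and $j$ have no common endpoint; (R3) $u_iu_ju_i=u_ju_iu_j$ whenever $i\neq j$ and edges $i,j$ share an endpoint; (R4) for each $r=1,\dots,9$: $u_{a_r}u_{b_r}u_{c_r}u_{d_r}u_{e_r}=u_{b_r}u_{c_r}u_{d_r}u_{e_r}u_{f_r}$. *)

(* Defs.v *)
(* Abstract (possibly infinite) groups are given by an
   explicit record with the group axioms; finitely presented groups are
   characterised by their universal property. *)
From mathcomp Require Import all_boot all_order all_algebra all_fingroup.
Set Implicit Arguments. Unset Strict Implicit. Unset Printing Implicit Defensive.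

Record agroup := AGroup {
  gcar :> Type;
  gmul : gcar -> gcar -> gcar;
  gone : gcar;
  ginv : gcar -> gcar;
  gmulA : forall a b c, gmul a (gmul b c) = gmul (gmul a b) c;
  gmul1 : forall a, gmul gone a = a;
  gmulV : forall a, gmul (ginv a) a = gone }.

Arguments gmul {_}. Arguments gone {_}. Arguments ginv {_}.
Notation "a ** b" := (gmul a b) (at level 40, left associativity).

Definition ghom (G G' : agroup) (f : G -> G') : Prop :=
  forall a b : G, f (a ** b) = f a ** f b.

Definition gker (G G' : agroup) (f : G -> G') : G -> Prop := fun a => f a = gone.

Definition gcomm (G : agroup) (a b : G) : G := ginv a ** ginv b ** a ** b.

Fixpoint gpown (G : agroup) (a : G) (n : nat) : G :=
  match n with O => gone | S n => gpown a n ** a end.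
Definition gpow (G : agroup) (a : G) (n : int) : G :=
  match n with Posz m => gpown a m | Negz m => ginv (gpown a m.+1) end.

Inductive gen_sub (G : agroup) (S : G -> Prop) : G -> Prop :=
| gen_one : gen_sub S gone
| gen_in  : forall a, S a -> gen_sub S a
| gen_mul : forall a b, gen_sub S a -> gen_sub S b -> gen_sub S (a ** b)
| gen_inv : forall a, gen_sub S a -> gen_sub S (ginv a).

Definition central (G : agroup) (a : G) : Prop := forall b : G, a ** b = b ** a.

Definition iso_on (G G' : agroup) (f : G -> G') (A : G -> Prop) (B : G' -> Prop) : Prop :=
  [/\ (forall a b, A a -> A b -> f (a ** b) = f a ** f b),
      (forall a, A a -> B (f a)),
      (forall a b, A a -> A b -> f a = f b -> a = b) &
      (forall b, B b -> exists a, A a /\ f a = b)].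

Definition PermGroup : agroup :=
  @AGroup {perm 'I_18} (fun s t => (s * t)%g) 1%g (fun s => s^-1)%g
    (@mulgA _) (@mul1g _) (@mulVg _).

Definition ZmodGroup (V : zmodType) : agroup :=
  @AGroup V (fun a b => (a + b)%R) 0%R (fun a => (- a)%R)
    (@GRing.addrA V) (@GRing.add0r V) (@GRing.addNr V).

Definition Z2 : agroup := ZmodGroup 'rV[int]_2.
Definition Z34 : agroup := ZmodGroup 'rV[int]_34.
Definition xZ : 'rV[int]_2 := delta_mx ord0 ord0.
Definition yZ : 'rV[int]_2 := delta_mx ord0 (inord 1).

(* edge j (1-based) joins the two (1-based) vertices listed *)
Definition edges : seq (nat * nat) :=
  [:: (2,7); (1,13); (4,9); (1,3); (1,5); (2,3); (2,6); (3,10); (4,6);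
      (4,5); (5,8); (6,14); (7,15); (7,11); (8,12); (8,16); (9,11); (9,17);
      (10,12); (10,18); (11,12); (13,15); (13,17); (14,18); (14,16);
      (15,16); (17,18)].

(* vertex v (1-based) as an element of 'I_18 (i.e. vertex v is v-1) *)
Definition vtx (v : nat) : 'I_18 := inord v.-1.
(* edge k (1-based) as an element of 'I_27 *)
Definition edg (k : nat) : 'I_27 := inord k.-1.

Definition ep1 (j : 'I_27) : 'I_18 := vtx (nth (0,0) edges j).1.
Definition ep2 (j : 'I_27) : 'I_18 := vtx (nth (0,0) edges j).2.

Definition share (i j : 'I_27) : bool :=
  [|| ep1 i == ep1 j, ep1 i == ep2 j, ep2 i == ep1 j | ep2 i == ep2 j].

(* the nine hexagons (a,b,c,d,e,f), edge labels 1-based *)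
Definition hexagons : seq (seq nat) :=
  [:: [:: 2;4;6;1;13;22]; [:: 1;7;9;3;17;14]; [:: 3;10;5;2;23;18];
      [:: 11;15;19;8;4;5]; [:: 8;20;24;12;7;6]; [:: 12;25;16;11;10;9];
      [:: 26;13;14;21;15;16]; [:: 21;17;18;27;20;19]; [:: 27;23;22;26;25;24]].

Definition T0 : seq 'I_27 :=
  map edg [:: 5;6;8;9;11;12;14;16;18;19;20;21;22;24;25;26;27].

Definition hex_rel (G : agroup) (g : 'I_27 -> G) (h : seq nat) : Prop :=
  let U k := g (edg (nth 0 h k)) in
  U 0 ** U 1 ** U 2 ** U 3 ** U 4 = U 1 ** U 2 ** U 3 ** U 4 ** U 5.

Definition CRel (G : agroup) (g : 'I_27 -> G) : Prop :=
  [/\ (forall j, g j ** g j = gone),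
      (forall i j, ~~ share i j -> g i ** g j = g j ** g i),
      (forall i j, i != j -> share i j ->
                   g i ** g j ** g i = g j ** g i ** g j) &
      (forall h, h \in hexagons -> hex_rel g h)].

Definition presentsC (C : agroup) (u : 'I_27 -> C) : Prop :=
  CRel u /\
  forall (G : agroup) (g : 'I_27 -> G), CRel g ->
    exists! f : C -> G, ghom f /\ forall j, f (u j) = g j.

Definition HRel (G : agroup) (x y : 'I_18 -> G) (z : G) : Prop :=
  [/\ (forall i j, i != j ->
         [/\ gcomm (x i) (x j) = gone, gcomm (y i) (y j) = gone &
             gcomm (x i) (y j) = gone]),
      (forall i, gcomm (x i) (y i) = z) &
      central z].

Definition presentsH (H : agroup) (x y : 'I_18 -> H) (z : H) : Prop :=
  HRel x y z /\
  forall (G : agroup) (x' y' : 'I_18 -> G) (z' : G), HRel x' y' z' ->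
    exists! f : H -> G,
      [/\ ghom f, (forall i, f (x i) = x' i), (forall i, f (y i) = y' i) & f z = z'].

(* Main.v *)
From HB Require Import structures.
Require Import Defs.
From mathcomp Require Import all_boot all_order all_algebra all_fingroup.
From mathcomp Require Import primitive_action alt ring zify.
Set Implicit Arguments. Unset Strict Implicit. Unset Printing Implicit Defensive.
Import GRing.Theory.

(* The dual of the torus triangulation lifts to a planar hexagonal lattice, so a
   reflection of C should be determined by a pair of vertices p, q of T and a
   displacement v in Z^2.  In the model S_18 |x Heis this is [srefl p q v].  Every
   such reflection is conjugate to a transposition, so conjugation slides reflections
   along one another, adding displacements, and (R1)-(R4) become finite checks.

   For injectivity, the edges of a Hamiltonian path of T satisfy the Coxeter
   relations, which gives iota : S_18 -> C.  Conjugating u_13 and u_8 by iota yields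
   families A_pq and B_pq (displacements (1,0) and (0,1)); this is well defined
   because hexagons imply that u_k commutes with the transposition of the two path
   neighbours of its inner endpoint.  The translations X_pq = tau_pq A_pq commute,
   X_pq X_qr = X_pr, and likewise for Y_pq = tau_pq B_pq; X_pq and Y_rs commute for
   distinct p, q, r, s.  Seven hexagons express the other edges, except u_15, through
   tau, A and B; the last two give two expressions of u_15, whose equality forces
   [X_pq, Y_ps] to be independent of p, hence central.  So every element of C is
   iota(s) X^a Y^b Z^c with a, b of sum zero, and these are separated by the model. *)

Arguments gmul {_} _ _ : simpl never.
Arguments gone {_} : simpl never.
Arguments ginv {_} _ : simpl never.

(** * Abstract groups *)

Section AbstractGroup.
Variable G : agroup.
Implicit Types a b c : G.

Lemma gmulrV a : a ** ginv a = gone.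
Proof.
rewrite -[LHS]gmul1 -[X in X ** _](gmulV (ginv a)) gmulA -(gmulA _ _ a).
by rewrite gmulV -gmulA gmul1 gmulV.
Qed.

Lemma gmulr1 a : a ** gone = a.
Proof. by rewrite -(gmulV a) gmulA gmulrV gmul1. Qed.

HB.instance Definition _ := Monoid.isLaw.Build G gone gmul (@gmulA G) (@gmul1 G) gmulr1.

Lemma gmulK a b : a ** b ** ginv b = a.
Proof. by rewrite -gmulA gmulrV gmulr1. Qed.

Lemma gmulVK a b : a ** ginv b ** b = a.
Proof. by rewrite -gmulA gmulV gmulr1. Qed.

Lemma gmulKl a b : ginv a ** (a ** b) = b.
Proof. by rewrite gmulA gmulV gmul1. Qed.

Lemma gmulVKl a b : a ** (ginv a ** b) = b.
Proof. by rewrite gmulA gmulrV gmul1. Qed.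

Lemma gmulI a b c : a ** b = a ** c -> b = c.
Proof. by move=> e; rewrite -(gmulKl a b) e gmulKl. Qed.

Lemma gmulIr a b c : b ** a = c ** a -> b = c.
Proof. by move=> e; rewrite -(gmulK b a) e gmulK. Qed.

Lemma ginv_eq a b : a ** b = gone -> ginv a = b.
Proof. by move=> e; apply: (@gmulI a); rewrite e gmulrV. Qed.

Lemma ginvK a : ginv (ginv a) = a.
Proof. by apply: ginv_eq; rewrite gmulV. Qed.

Lemma ginvM a b : ginv (a ** b) = ginv b ** ginv a.
Proof. by apply: ginv_eq; rewrite gmulA gmulK gmulrV. Qed.

Lemma ginv1 : ginv gone = gone :> G.
Proof. by apply: ginv_eq; rewrite gmul1. Qed.

Definition subgroup (P : G -> Prop) : Prop :=
  [/\ P gone, forall a b, P a -> P b -> P (a ** b) & forall a, P a -> P (ginv a)].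

Lemma gen_sub_min (S P : G -> Prop) : subgroup P -> (forall a, S a -> P a) ->
  forall a, gen_sub S a -> P a.
Proof.
by move=> [P1 PM PV] SP a; elim=> // [b c _ Pb _ Pc|b _ Pb]; [exact: PM | exact: PV].
Qed.

Lemma subgroup_gen_sub (S : G -> Prop) : subgroup (gen_sub S).
Proof. by split; [exact: gen_one | exact: gen_mul | exact: gen_inv]. Qed.

Definition gcommute a b : Prop := a ** b = b ** a.

Lemma gcommuteC a b : gcommute a b -> gcommute b a.
Proof. by []. Qed.

Lemma gcommute1 a : gcommute a gone.
Proof. by rewrite /gcommute gmul1 gmulr1. Qed.

Lemma gcommuteM a b c : gcommute a b -> gcommute a c -> gcommute a (b ** c).
Proof. by rewrite /gcommute => ab ac; rewrite gmulA ab -gmulA ac gmulA. Qed.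

Lemma gcommuteV a b : gcommute a b -> gcommute a (ginv b).
Proof. by rewrite /gcommute => ab; apply: (@gmulI b); rewrite !gmulA -ab gmulK gmulrV gmul1. Qed.

Lemma gcommuteMl a b c : gcommute b a -> gcommute c a -> gcommute (b ** c) a.
Proof. by move=> *; apply/gcommuteC/gcommuteM; apply/gcommuteC. Qed.

Definition gconj a b : G := ginv b ** a ** b.

Lemma gconjP a b c : gconj a b = c <-> a ** b = b ** c.
Proof.
by rewrite /gconj; split=> [<-|e]; rewrite -!gmulA ?gmulVKl // e gmulKl.
Qed.

Lemma gconjE a b : a ** b = b ** gconj a b.
Proof. exact/gconjP. Qed.

Lemma gconjM a b c : gconj (a ** b) c = gconj a c ** gconj b c.
Proof. by rewrite /gconj !gmulA gmulK. Qed.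

Lemma gconjMr a b c : gconj a (b ** c) = gconj (gconj a b) c.
Proof. by rewrite /gconj ginvM !gmulA. Qed.

Lemma gconj1r a : gconj a gone = a.
Proof. by rewrite /gconj ginv1 gmul1 gmulr1. Qed.

Lemma gconj1 a : gconj gone a = gone.
Proof. by rewrite /gconj gmulr1 gmulV. Qed.

Lemma gconjV a b : gconj (ginv a) b = ginv (gconj a b).
Proof. by rewrite /gconj !ginvM ginvK gmulA. Qed.

Lemma gconj_id a : gconj a a = a.
Proof. exact/gconjP. Qed.

Lemma gconjJ a b c : gconj (gconj a b) c = gconj (gconj a c) (gconj b c).
Proof. by rewrite -gconjMr gconjE gconjMr /gconj !gmulA ?gmulK. Qed.

Lemma gconj_inj a b c : gconj a c = gconj b c -> a = b.
Proof. by rewrite /gconj => /gmulIr /gmulI. Qed.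

Lemma gcommute_gconjP a b : gcommute a b <-> gconj a b = a.
Proof. by rewrite gconjP. Qed.

Lemma gcommute_gconj a b c : gcommute a b -> gcommute (gconj a c) (gconj b c).
Proof. by rewrite /gcommute -!gconjM => ->. Qed.

Lemma subgroup_gconj (P : G -> Prop) a b : subgroup P -> P a -> P b -> P (gconj a b).
Proof. by case=> _ PM PV Pa Pb; apply: (PM _ _ (PM _ _ (PV _ Pb) Pa) Pb). Qed.

Lemma subgroup_gcomm (P : G -> Prop) a b : subgroup P -> P a -> P b -> P (gcomm a b).
Proof. by case=> _ PM PV Pa Pb; apply/PM/Pb/PM/Pa/PM/PV/Pb/PV. Qed.

Lemma subgroup_centralizer a : subgroup (gcommute a).
Proof. by split; [exact: gcommute1 | exact: gcommuteM | exact: gcommuteV]. Qed.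

Definition braid a b : Prop := a ** b ** a = b ** a ** b.

Lemma braid_gconj a b c : braid a b -> braid (gconj a c) (gconj b c).
Proof. by rewrite /braid -!gconjM => ->. Qed.

Lemma gconj_involution a b : b ** b = gone -> gconj a b = b ** a ** b.
Proof. by rewrite /gconj => /ginv_eq ->. Qed.

Lemma braid_involutionP a b : a ** a = gone -> b ** b = gone ->
  braid a b <-> gconj a b = gconj b a.
Proof. by move=> aa bb; rewrite !gconj_involution //; split; exact: esym. Qed.

Lemma gcommE a b : gcomm a b = ginv a ** gconj a b.
Proof. by rewrite /gcomm /gconj !gmulA. Qed.

Lemma gconj_gcomm a b : gconj a b = a ** gcomm a b.
Proof. by rewrite gcommE gmulVKl. Qed.

Lemma gcommP a b c : gcomm a b = c <-> a ** b = b ** a ** c.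
Proof.
rewrite gcommE; split=> [<-|]; first by rewrite -gmulA gmulVKl gconjE.
by rewrite -gmulA => /gconjP ->; rewrite gmulKl.
Qed.

Lemma gcommC a b : a ** b = b ** a ** gcomm a b.
Proof. exact/gcommP. Qed.

Lemma gcomm_eq1 a b : gcomm a b = gone <-> gcommute a b.
Proof. by rewrite gcommP gmulr1. Qed.

Lemma gconj_gcommE a b c : gconj (gcomm a b) c = gcomm (gconj a c) (gconj b c).
Proof. by rewrite /gcomm !gconjM !gconjV. Qed.

Lemma gcommMl a b c : gcommute (gcomm a c) b -> gcomm (a ** b) c = gcomm a c ** gcomm b c.
Proof.
rewrite [gcomm (a ** b) c]gcommE gconjM !gconj_gcomm ginvM.
by move: (gcomm a c) (gcomm b c) => z z' zb; rewrite -!gmulA gmulKl (gmulA z) zb -gmulA gmulKl.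
Qed.

Lemma gcommMl_commute a b c : gcommute a c -> gcomm (a ** b) c = gcomm b c.
Proof. by move=> /gcomm_eq1 ac; rewrite gcommMl ac ?gmul1 //; apply/gcommuteC/gcommute1. Qed.

Lemma gcommMr_commute a b c : gcommute a b -> gcomm a (b ** c) = gcomm a c.
Proof. by move=> /gcommute_gconjP ab; rewrite !gcommE gconjMr ab. Qed.

Lemma gcommVr a b : gcomm a (ginv b) = ginv (gconj (gcomm a b) (ginv b)).
Proof. by rewrite /gcomm /gconj !ginvM !ginvK !gmulA gmulrV gmul1. Qed.

Lemma gcommVV a b : gcommute a (gcomm a b) -> gcommute b (gcomm a b) ->
  gcomm (ginv a) (ginv b) = gcomm a b.
Proof.
move=> az bz.
by rewrite {1}/gcomm !ginvK (gcommC a) (gcommuteMl bz az) gmulA gmulK gmulK.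
Qed.

End AbstractGroup.
Arguments gconj {G} a b.

Section Homomorphism.
Variables (G K : agroup) (f : G -> K).
Hypothesis fM : ghom f.

Lemma ghom1 : f gone = gone.
Proof. by apply: (@gmulI _ (f gone)); rewrite -fM gmul1 gmulr1. Qed.

Lemma ghomV a : f (ginv a) = ginv (f a).
Proof. by apply/esym/ginv_eq; rewrite -fM gmulrV ghom1. Qed.

Lemma ghom_gconj a b : f (gconj a b) = gconj (f a) (f b).
Proof. by rewrite /gconj !fM ghomV. Qed.

Lemma ghom_gcomm a b : f (gcomm a b) = gcomm (f a) (f b).
Proof. by rewrite /gcomm !fM !ghomV. Qed.

Lemma subgroup_preimage (P : K -> Prop) : subgroup P -> subgroup (fun a => P (f a)).
Proof.
case=> P1 PM PV; split=> [|a b Pa Pb|a Pa]; first by rewrite ghom1.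
- by rewrite fM; apply: PM.
- by rewrite ghomV; apply: PV.
Qed.

Lemma subgroup_image (P : G -> Prop) : subgroup P -> subgroup (fun b => exists a, P a /\ f a = b).
Proof.
case=> P1 PM PV; split=> [|_ _ [a [Pa <-]] [b [Pb <-]]|_ [a [Pa <-]]].
- by exists gone; rewrite ghom1.
- by exists (a ** b); rewrite fM; split=> //; apply: PM.
- by exists (ginv a); rewrite ghomV; split=> //; apply: PV.
Qed.

Lemma subgroup_range : subgroup (fun b => exists a, f a = b).
Proof.
split=> [|_ _ [a <-] [b <-]|_ [a <-]].
- by exists gone; rewrite ghom1.
- by exists (a ** b); rewrite fM.
- by exists (ginv a); rewrite ghomV.
Qed.

End Homomorphism.

Lemma gconj_hom (G : agroup) (b : G) : ghom (fun a => gconj a b).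
Proof. by move=> a a'; apply: gconjM. Qed.

Lemma subgroup_equalizer (G K : agroup) (f g : G -> K) : ghom f -> ghom g ->
  subgroup (fun a => f a = g a).
Proof.
move=> fM gM; split=> [|a b fa fb|a fa]; first by rewrite !ghom1.
- by rewrite fM gM fa fb.
- by rewrite !ghomV ?fa.
Qed.

Lemma unique_factorization (G Q : agroup) (f : G -> Q) (L : G -> Prop) : ghom f ->
  (forall a b, L a -> L b -> f a = f b -> a = b) -> (forall s, exists a, L a /\ f a = s) ->
  forall c, exists! kl : G * G, [/\ gker f kl.1, L kl.2 & c = kl.1 ** kl.2].
Proof.
move=> fM f_inj f_surj c; have [l [Ll fl]] := f_surj (f c).
exists (c ** ginv l, l); split=> [|[k' l'] /= [fk Ll' ce]].
  by split; rewrite //= ?gmulVK // /gker fM (ghomV fM) fl gmulrV.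
have <- : l' = l by apply: f_inj; rewrite // fl ce fM fk gmul1.
by rewrite ce gmulK.
Qed.

Lemma ghom_comp (G K L : agroup) (f : K -> L) (g : G -> K) :
  ghom f -> ghom g -> ghom (fun a => f (g a)).
Proof. by move=> fM gM a b; rewrite gM fM. Qed.

(** * Integer powers and homomorphisms out of a free abelian group *)

Section Powers.
Variable G : agroup.
Implicit Types a b : G.
Local Open Scope ring_scope.

Lemma gpownSr a n : gpown a n.+1 = a ** gpown a n.
Proof.
elim: n => [|n IH]; first by rewrite /= gmulr1 gmul1.
by rewrite [LHS]/= -/(gpown a n.+1) {1}IH -gmulA.
Qed.

Lemma gpow_succ a (n : int) : gpow a (n + 1) = gpow a n ** a.
Proof.
case: n => [n|[|n]]; first by rewrite -PoszD addn1.
  by rewrite /= gmul1 gmulV.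
have -> : Negz n.+1 + 1 = Negz n by lia.
by rewrite /gpow (gpownSr a n.+1) ginvM gmulVK.
Qed.

Lemma gpow_pred a (n : int) : gpow a (n - 1) = gpow a n ** ginv a.
Proof. by apply: (@gmulIr _ a); rewrite -gpow_succ subrK gmulVK. Qed.

Lemma gpowD a (m n : int) : gpow a (m + n) = gpow a m ** gpow a n.
Proof.
elim: n => [|n IH|n IH].
- by rewrite addr0 gmulr1.
- by rewrite -addn1 PoszD addrA !gpow_succ IH gmulA.
- by rewrite -addn1 PoszD opprD addrA !gpow_pred IH gmulA.
Qed.

Lemma gpowN a (n : int) : gpow a (- n) = ginv (gpow a n).
Proof. by apply/esym/ginv_eq; rewrite -gpowD subrr. Qed.

Lemma gpow1 a : gpow a 1 = a.
Proof. by rewrite /= gmul1. Qed.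

Lemma subgroup_gpow (P : G -> Prop) a n : subgroup P -> P a -> P (gpow a n).
Proof.
case=> P1 PM PV Pa; elim: n => [|n IH|n IH] //.
- by rewrite -addn1 PoszD gpow_succ; apply: PM.
- by rewrite -addn1 PoszD opprD gpow_pred; apply: PM => //; apply: PV.
Qed.

Lemma gcommute_gpow a b n : gcommute a b -> gcommute a (gpow b n).
Proof. by move=> ab; apply: subgroup_gpow => //; apply: subgroup_centralizer. Qed.

Lemma subgroup_big (P : G -> Prop) (I : Type) (r : seq I) (F : I -> G) :
  subgroup P -> (forall i, P (F i)) -> P (\big[gmul/gone]_(i <- r) F i).
Proof. by case=> P1 PM _ PF; elim/big_ind: _. Qed.

Lemma ghom_mulrz (V : zmodType) (f : ZmodGroup V -> G) : ghom f ->
  forall (v : V) n, f (v *~ n) = gpow (f v) n.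
Proof.
move=> fM v; have fN w : f (- w : V) = ginv (f w) := ghomV fM w.
have fD w w' : f (w + w' : V) = f w ** f w' := fM w w'.
elim=> [|n IH|n IH].
- by rewrite mulr0z; exact: (ghom1 fM).
- by rewrite -addn1 PoszD mulrzDr mulr1z fD IH gpow_succ.
- by rewrite -addn1 PoszD opprD mulrzDr fD IH mulrNz mulr1z fN gpow_pred.
Qed.

Lemma ghom_rV_eq n (f g : ZmodGroup 'rV[int]_n -> G) : ghom f -> ghom g ->
  (forall i, f (delta_mx 0 i) = g (delta_mx 0 i)) -> forall v, f v = g v.
Proof.
move=> fM gM fg v; rewrite (row_sum_delta v).
elim/big_ind: _ => [|w w' fgw fgw'|i _]; first by rewrite (ghom1 fM) (ghom1 gM).
  by rewrite (fM w w') (gM w w') fgw fgw'.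
by rewrite -[v 0 i]intz scaler_int !ghom_mulrz ?fg.
Qed.

Definition gprodz n (X : 'I_n -> G) (v : 'rV[int]_n) : G :=
  \big[gmul/gone]_(i < n) gpow (X i) (v 0 i).

Lemma subgroup_gprodz (P : G -> Prop) n (X : 'I_n -> G) v :
  subgroup P -> (forall i, P (X i)) -> P (gprodz X v).
Proof. by move=> sP PX; apply: subgroup_big => // i; apply: subgroup_gpow. Qed.

Lemma gcommute_gprodz n (X : 'I_n -> G) v b :
  (forall i, gcommute b (X i)) -> gcommute b (gprodz X v).
Proof. by move=> bX; apply: subgroup_gprodz => //; apply: subgroup_centralizer. Qed.

Lemma gprodz_hom n (X : 'I_n -> G) : (forall i j, gcommute (X i) (X j)) ->
  @ghom (ZmodGroup 'rV[int]_n) G (gprodz X).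
Proof.
move=> XX v w; rewrite /gprodz; elim: (index_enum _) => [|i r IH].
  by rewrite !big_nil gmul1.
rewrite !big_cons IH mxE gpowD -!gmulA; congr (_ ** _); rewrite !gmulA; congr (_ ** _).
apply: (@subgroup_big (gcommute (gpow (X i) (w 0 i)))) => [|j].
  exact: subgroup_centralizer.
by apply/gcommute_gpow/gcommuteC/gcommute_gpow.
Qed.

Lemma gprodz_delta n (X : 'I_n -> G) i : gprodz X (delta_mx 0 i) = X i.
Proof.
rewrite /gprodz (big_only1 i) // => [|j ji _]; rewrite mxE !eqxx; first exact: gpow1.
by rewrite (negPf ji).
Qed.

Lemma gprodz0 n (X : 'I_n -> G) : gprodz X 0 = gone.
Proof. by rewrite /gprodz big1 // => i _; rewrite mxE. Qed.

End Powers.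

Lemma ghom_gpow (G K : agroup) (f : G -> K) a n : ghom f -> f (gpow a n) = gpow (f a) n.
Proof.
move=> fM; elim: n => [|n IH|n IH].
- exact: ghom1.
- by rewrite -addn1 PoszD !gpow_succ fM IH.
- by rewrite -addn1 PoszD opprD !gpow_pred fM IH ghomV.
Qed.

(** * Permutations *)

Ltac distinct :=
  repeat match goal with
  | H : is_true (uniq _) |- _ => rewrite /= ?inE ?negb_or in H
  | H : is_true (_ \notin _) |- _ => rewrite ?inE ?negb_or in H
  | H : is_true (_ && _) |- _ => case/andP: H => ? ?
  end;
  rewrite /= ?inE ?negb_or; repeat (apply/andP; split); solve [by [] | by rewrite eq_sym].

Definition SymGroup (T : finType) : agroup :=
  @AGroup {perm T} (fun s t => (s * t)%g) 1%g (fun s => s^-1)%g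
    (@mulgA _) (@mul1g _) (@mulVg _).

Lemma symgroupM (T : finType) (s t : SymGroup T) x : (s ** t : SymGroup T) x = t (s x).
Proof. exact: permM. Qed.

Lemma symgroupJ (T : finType) (s t : SymGroup T) : gconj s t = (s ^ t)%g.
Proof. by rewrite conjgE mulgA. Qed.

Lemma perm_map_exists (T : finType) (s t : seq T) : uniq s -> uniq t -> size s = size t ->
  exists f : {perm T}, map f s = t.
Proof.
move=> us ut st; have sT : size s <= #|T| by rewrite -(card_uniqP us) max_card.
have tr := ntransitive_weak sT (Sym_trans T).
have dt (w : seq T) (sw : size w == size s) : uniq w -> Tuple sw \in (size s).-dtuple([set: T]).
  by move=> uw; rewrite inE uw; apply/subsetP=> x; rewrite inE.
have ts : size t == size s by rewrite st.
have [f _ /(congr1 val) /= ->] := atransP2 tr (dt _ (eqxx _) us) (dt _ ts ut).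
by exists f.
Qed.

Lemma exists_notin (T : finType) (s : seq T) : size s < #|T| -> exists x, x \notin s.
Proof.
move=> sT; have /subsetPn[x _ xs] : ~~ ([set: T] \subset s); last by exists x.
apply: contraL sT => /subset_leq_card; rewrite cardsT -leqNgt => /leq_trans; apply.
exact: card_size.
Qed.

Lemma tperm_braid (T : finType) (p q r : T) : uniq [:: p; q; r] ->
  (tperm p q * tperm q r * tperm p q = tperm p r)%g.
Proof.
move=> u; rewrite -mulgA -{1}[tperm p q]tpermV -conjgE tpermJ tpermR tpermD //; distinct.
Qed.

(* A single pass: an edge is used only if it meets the vertices reached before it. *)
Fixpoint reach (U : eqType) (seen : seq U) (es : seq (U * U)) : seq U :=
  if es is (a, b) :: es' then
    reach (if a \in seen then b :: seen else if b \in seen then a :: seen else seen) es'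
  else seen.

Section PermInduction.
Variables (T : finType) (P : {perm T} -> Prop).
Hypotheses (P1 : P 1%g) (PM : forall s t, P s -> P t -> P (s * t)%g).

Lemma tperm_closed_trans a b c : P (tperm a b) -> P (tperm b c) -> P (tperm a c).
Proof.
have [->//|ab] := eqVneq a b; have [->//|bc] := eqVneq b c.
have [->|ac] := eqVneq a c; first by rewrite tperm1.
by move=> Pab Pbc; rewrite -(@tperm_braid _ a b c); [apply: PM => //; apply: PM | distinct].
Qed.

Lemma tperm_reach (U : eqType) (f : U -> T) r seen es :
  (forall v, v \in seen -> P (tperm (f r) (f v))) ->
  (forall e, e \in es -> P (tperm (f e.1) (f e.2))) ->
  forall v, v \in reach seen es -> P (tperm (f r) (f v)).
Proof.
elim: es seen => //= -[a b] es IH seen Pseen Pes; apply: IH => [v|e ein]; last first.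
  by apply: Pes; rewrite inE ein orbT.
have Pab := Pes _ (mem_head _ _); case: ifP => [/Pseen Pa|_].
  by rewrite inE => /orP[/eqP->|/Pseen //]; apply: tperm_closed_trans Pab.
case: ifP => [/Pseen Pb|_]; last exact: Pseen.
by rewrite inE => /orP[/eqP->|/Pseen //]; apply: tperm_closed_trans Pb _; rewrite tpermC.
Qed.

Lemma perm_ind_on (S : seq T) :
  {in S &, forall a b, P (tperm a b)} ->
  forall s : {perm T}, (forall x, x \notin S -> s x = x) -> P s.
Proof.
elim: S => [_ s fix_s|x S IH PS s fix_s].
  by rewrite (_ : s = 1%g) //; apply/permP=> x; rewrite perm1 fix_s.
rewrite -(mulgK (tperm (s x) x) s) tpermV; apply: PM; last first.
  apply: PS (mem_head _ _); apply: contraT => sxS.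
  by have := sxS; rewrite (perm_inj (fix_s _ sxS)) mem_head.
apply: IH => [a b aS bS|y yS]; first by apply: PS; rewrite inE ?aS ?bS orbT.
rewrite permM; have [->|yx] := eqVneq y x; first exact: tpermL.
have sy : s y = y by apply: fix_s; rewrite inE negb_or yx.
by rewrite sy tpermD 1?eq_sym // -[X in X != _]sy (inj_eq perm_inj).
Qed.

Lemma reach_perm_ind (U : eqType) (f : U -> T) r es :
  (forall e, e \in es -> P (tperm (f e.1) (f e.2))) ->
  forall s : {perm T}, (forall x, x \notin map f (reach [:: r] es) -> s x = x) -> P s.
Proof.
move=> Pes; have Pr v : v \in reach [:: r] es -> P (tperm (f r) (f v)).
  by apply: tperm_reach => // w; rewrite inE => /eqP->; rewrite tperm1.
apply: perm_ind_on => _ _ /mapP[v vr ->] /mapP[w wr ->].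
by apply: tperm_closed_trans (Pr w wr); rewrite tpermC; apply: Pr.
Qed.

End PermInduction.

(** * The Coxeter presentation of the symmetric group *)

Definition coxeter (G : agroup) (n : nat) (t : nat -> G) : Prop :=
  [/\ forall i, i < n -> t i ** t i = gone,
      forall i j, i.+1 < j -> j < n -> gcommute (t i) (t j) &
      forall i, i.+1 < n -> braid (t i) (t i.+1)].

Fixpoint descent (G : agroup) (t : nat -> G) (m d : nat) : G :=
  if d is d'.+1 then t (m + d') ** descent t m d' else gone.

Lemma descentSr (G : agroup) (t : nat -> G) m d :
  descent t m d.+1 = descent t m.+1 d ** t m.
Proof.
elim: d => [|d IH]; first by rewrite /= addn0 gmul1 gmulr1.
by rewrite [LHS]/= -/(descent t m d.+1) IH gmulA addnS.
Qed.

Section Descent.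
Variables (G : agroup) (n : nat) (t : nat -> G).
Hypothesis cox : coxeter n t.

Lemma descent_commute_lt m d i : i.+1 < m -> m + d <= n -> gcommute (t i) (descent t m d).
Proof.
move=> im; elim: d => [|d IH] mdn; first exact: gcommute1.
by case: cox => _ tt _; apply: gcommuteM; [apply: tt; lia | apply: IH; lia].
Qed.

Lemma descent_commute_gt m d i : m + d < i -> i < n -> gcommute (t i) (descent t m d).
Proof.
move=> + in_; elim: d => [|d IH] mdi; first exact: gcommute1.
case: cox => _ tt _; apply: gcommuteM; last by apply: IH; lia.
by apply/gcommuteC/tt; lia.
Qed.

Lemma descent_shift m d i : m < i < m + d -> m + d <= n ->
  descent t m d ** t i = t i.-1 ** descent t m d.
Proof.
case: cox => _ tt br; elim: d => [|d IH] imd mdn; first lia.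
have [im|im] := ltnP i (m + d).
  rewrite [descent _ _ _]/= -gmulA IH ?gmulA; try lia.
  by congr (_ ** _); apply/gcommuteC/tt; lia.
have {im}ei : i = m + d by lia.
case: d imd mdn ei {IH} => [|d] imd mdn ei; first lia.
rewrite /= addnS in ei *; rewrite -!gmulA -(@descent_commute_gt m d i); [|lia|lia].
by rewrite ei !gmulA /=; congr (_ ** _); rewrite -(br (m + d)) //; lia.
Qed.

End Descent.

Section CoxeterPresentation.
Variable n : nat.
Notation Sym := (SymGroup 'I_n.+1).

Definition adj (i : nat) : Sym := tperm (inord i : 'I_n.+1) (inord i.+1).

Lemma inord_eq (i j : nat) : i <= n -> j <= n -> (inord i == inord j :> 'I_n.+1) = (i == j).
Proof. by move=> hi hj; rewrite -val_eqE /= !inordK. Qed.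

Lemma adj_coxeter : coxeter n adj.
Proof.
split=> [i _|i j ij jn|i i_n]; first exact: tperm2.
  by apply/gcommute_gconjP; rewrite symgroupJ tpermJ !tpermD ?inord_eq //; lia.
have u : uniq [:: inord i; inord i.+1; inord i.+2 : 'I_n.+1].
  by rewrite /= !inE !inord_eq //; lia.
have u' : uniq [:: inord i.+2; inord i.+1; inord i : 'I_n.+1] by distinct.
rewrite /braid /gmul /= /adj tperm_braid // ![tperm (inord i) _]tpermC.
by rewrite [tperm (inord i.+1) _]tpermC tperm_braid.
Qed.

Lemma adj_fix i j : i < n -> j <= n -> j != i -> j != i.+1 -> adj i (inord j) = inord j.
Proof. by move=> *; rewrite tpermD ?inord_eq // 1?eq_sym //; lia. Qed.

Lemma descent_adj_fix m d j : m + d < j -> j <= n -> descent adj m d (inord j) = inord j.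
Proof.
elim: d => [|d IH] mdj jn; first by rewrite /= perm1.
by rewrite symgroupM adj_fix; try lia; apply: IH; lia.
Qed.

Lemma descent_adj_last m d : m + d <= n -> descent adj m d (inord (m + d)) = inord m.
Proof.
elim: d => [|d IH] mdn; first by rewrite addn0 /= perm1.
by rewrite symgroupM addnS tpermR IH //; lia.
Qed.

Definition fixes_from (k : nat) (s : Sym) : Prop :=
  forall j, k <= j -> j <= n -> s (inord j) = inord j.

Lemma fixes_from_bound k (s : Sym) : k <= n -> fixes_from k.+1 s -> s (inord k) <= k.
Proof.
move=> kn fix_s; rewrite leqNgt; apply/negP => ks.
have := fix_s _ ks (leq_ord _); rewrite inord_val => /perm_inj sk.
by move: ks; rewrite sk inordK ?ltnn.
Qed.

Definition top_descent k (s : Sym) : Sym := descent adj (s (inord k)) (k - s (inord k)).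

Lemma fixes_from_top k (s : Sym) : k <= n -> fixes_from k.+1 s ->
  fixes_from k (s ** ginv (top_descent k s)).
Proof.
move=> kn fix_s j kj jn; have sk := fixes_from_bound kn fix_s.
rewrite symgroupM; apply: (canLR (permK _)).
have [->|jk] : j = k \/ k < j by lia.
  by have := @descent_adj_last (s (inord k)) (k - s (inord k)); rewrite subnKC // inord_val => ->.
by rewrite fix_s // descent_adj_fix //; lia.
Qed.

Lemma adj_ind (P : Sym -> Prop) : P gone ->
  (forall s i, i < n -> P s -> P (s ** adj i)) -> forall s, P s.
Proof.
move=> P1 PM; have Pdescent s m d : m + d <= n -> P s -> P (s ** descent adj m d).
  elim: d m => [|d IH] m mdn Ps; first by rewrite gmulr1.
  by rewrite descentSr gmulA; apply: PM; [lia | apply: IH; [lia |]].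
suff Pk k s : k <= n.+1 -> fixes_from k s -> P s by move=> s; apply: (@Pk n.+1) => // j; lia.
elim: k s => [|k IH] s kn fix_s.
  rewrite (_ : s = gone) //; apply/permP => j.
  by have := fix_s j; rewrite inord_val perm1; apply=> //; rewrite -ltnS.
rewrite -(gmulVK s (top_descent k s)); apply: Pdescent.
  by rewrite subnKC //; apply: fixes_from_bound.
by apply: IH; [lia | apply: fixes_from_top].
Qed.

Section Extension.
Variables (G : agroup) (t : nat -> G).
Hypothesis cox : coxeter n t.

Fixpoint coxeter_ext (k : nat) (s : Sym) : G :=
  if k is k'.+1 then
    coxeter_ext k' (s ** ginv (top_descent k' s))
      ** descent t (s (inord k')) (k' - s (inord k'))
  else gone.

Lemma coxeter_extS k s : coxeter_ext k.+1 s = coxeter_ext k (s ** ginv (top_descent k s))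
  ** descent t (s (inord k)) (k - s (inord k)).
Proof. by []. Qed.

Lemma coxeter_ext1 k : k <= n.+1 -> coxeter_ext k gone = gone.
Proof.
elim: k => // k IH kn; rewrite coxeter_extS /top_descent !perm1 inordK // subnn.
by rewrite gmulr1 gmulrV IH // ltnW.
Qed.

(* The four cases are those of the position of [i] relative to the image [m] of
   the top point [k]: [adj i] passes the descent from [k] to [m] unchanged or
   lowered by one, or it lengthens or shortens it. *)
Lemma coxeter_ext_adj k s i : k <= n.+1 -> fixes_from k s -> i.+1 < k ->
  coxeter_ext k (s ** adj i) = coxeter_ext k s ** t i.
Proof.
elim: k s i => // k IH s i kn fix_s ik.
have mk := fixes_from_bound kn fix_s; have fix_s' := fixes_from_top kn fix_s.
rewrite !coxeter_extS /top_descent symgroupM; rewrite /top_descent in fix_s'.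
set m := s (inord k) in mk fix_s' *; have em : m = inord m by rewrite inord_val.
have [im|[im|[im|im]]] : i.+1 < m \/ i.+1 = m \/ i = m \/ m < i by lia.
- rewrite {1 2 3 4}em adj_fix // ?inord_val; try lia.
  have /gcommuteV adjD := @descent_commute_lt _ _ _ adj_coxeter m (k - m) _ im ltac:(lia).
  have tD := @descent_commute_lt _ _ _ cox m (k - m) _ im ltac:(lia).
  by rewrite -(gmulA s) adjD (gmulA s) IH -?gmulA ?tD //; lia.
- have -> : adj i m = inord i by rewrite em -im /adj tpermR.
  rewrite inordK; last lia.
  have -> : k - i = (k - m).+1 by lia.
  by rewrite !descentSr im ginvM -!gmulA (gmulA (adj i)) gmulrV gmul1 !gmulA.
- have -> : adj i m = inord i.+1 by rewrite em im /adj tpermL.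
  rewrite inordK; last lia.
  have -> : k - m = (k - i.+1).+1 by lia.
  have [/(_ i) tt _ _] := cox; have [/(_ i) aa _ _] := adj_coxeter.
  by rewrite -im !descentSr ginvM -!gmulA tt ?(ginv_eq (aa _)) ?gmulr1 //; lia.
- have -> : adj i m = m by rewrite em adj_fix //; lia.
  have mik : m < i < m + (k - m) by lia.
  have adjD := descent_shift adj_coxeter mik ltac:(lia).
  have tD := descent_shift cox mik ltac:(lia).
  have {adjD}-> : s ** adj i ** ginv (descent adj m (k - m))
      = s ** ginv (descent adj m (k - m)) ** adj i.-1.
    by apply: (@gmulIr _ (descent adj m (k - m))); rewrite gmulVK -!gmulA -adjD gmulKl.
  by rewrite IH -?gmulA ?tD //; lia.
Qed.

Theorem coxeter_hom : exists2 f : Sym -> G, ghom f & forall i, i < n -> f (adj i) = t i.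
Proof.
have extM s i : i < n -> coxeter_ext n.+1 (s ** adj i) = coxeter_ext n.+1 s ** t i.
  by move=> i_n; apply: coxeter_ext_adj => // j; lia.
exists (coxeter_ext n.+1) => [s s'|i i_n]; last first.
  by rewrite -[adj i]gmul1 extM // coxeter_ext1 // gmul1.
elim/adj_ind: s' => [|s' i i_n IH]; first by rewrite coxeter_ext1 // !gmulr1.
by rewrite gmulA !extM // IH gmulA.
Qed.

End Extension.

Lemma coxeter_path_hom (G : agroup) (t : nat -> G) (p : {perm 'I_n.+1}) : coxeter n t ->
  exists2 f : Sym -> G, ghom f &
    forall i, i < n -> f (tperm (p (inord i)) (p (inord i.+1))) = t i.
Proof.
case/coxeter_hom=> f fM ft; exists (fun s => f (gconj s (ginv (p : Sym)))) => [s s'|i i_n].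
  by rewrite gconjM fM.
by rewrite -ft // symgroupJ tpermJ !permK.
Qed.

End CoxeterPresentation.

(** * Semidirect products *)

Section SemidirectProduct.
Variables (Q K : agroup) (act : Q -> K -> K).
Hypotheses (actM : forall q, ghom (act q)) (act1 : forall k, act gone k = k).
Hypothesis act_comp : forall p q k, act (p ** q) k = act q (act p k).

Definition sd_mul (m m' : Q * K) : Q * K := (m.1 ** m'.1, act m'.1 m.2 ** m'.2).
Definition sd_one : Q * K := (gone, gone).
Definition sd_inv (m : Q * K) : Q * K := (ginv m.1, act (ginv m.1) (ginv m.2)).

Lemma sd_mulA m1 m2 m3 : sd_mul m1 (sd_mul m2 m3) = sd_mul (sd_mul m1 m2) m3.
Proof. by rewrite /sd_mul /= act_comp actM !gmulA. Qed.

Lemma sd_mul1 m : sd_mul sd_one m = m.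
Proof. by case: m => q k; rewrite /sd_mul /= (ghom1 (actM _)) !gmul1. Qed.

Lemma sd_mulV m : sd_mul (sd_inv m) m = sd_one.
Proof. by rewrite /sd_mul /= -act_comp gmulV act1 gmulV. Qed.

Definition sdprod_agroup : agroup := AGroup sd_mulA sd_mul1 sd_mulV.

Definition sdl (q : Q) : sdprod_agroup := (q, gone).
Definition sdr (k : K) : sdprod_agroup := (gone, k).

Lemma sdE (m : sdprod_agroup) : m = sdl m.1 ** sdr m.2.
Proof. by case: m => q k; rewrite [RHS]/(sd_mul _ _) /sd_mul /= (ghom1 (actM _)) gmul1 gmulr1. Qed.

Lemma sdlM : ghom sdl.
Proof. by move=> p q; rewrite [RHS]/(sd_mul _ _) /sd_mul /= (ghom1 (actM _)) gmul1. Qed.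

Lemma sdrM : ghom sdr.
Proof. by move=> k l; rewrite [RHS]/(sd_mul _ _) /sd_mul /= gmul1 act1. Qed.

Lemma sdr_conj q k : gconj (sdr k) (sdl q) = sdr (act q k).
Proof.
apply/gconjP; rewrite -(sdE (q, act q k)).
by rewrite [LHS]/(sd_mul _ _) /sd_mul /= gmul1 gmulr1.
Qed.

Lemma sd_hom_on (G : agroup) (i : Q -> G) (h : K -> G) (P : K -> Prop) :
  ghom i -> (forall k l, P k -> P l -> h (k ** l) = h k ** h l) ->
  (forall q k, P k -> P (act q k)) ->
  (forall q k, P k -> gconj (h k) (i q) = h (act q k)) ->
  forall m m' : sdprod_agroup, P m.2 -> P m'.2 ->
    i (m ** m').1 ** h (m ** m').2 = (i m.1 ** h m.2) ** (i m'.1 ** h m'.2).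
Proof.
move=> iM hM Pact hact [q k] [q' k'] /= Pk Pk'.
rewrite iM hM -?hact //; last exact: Pact.
by rewrite -!(gmulA (i q)) (gmulA (h k)) (gconjE (h k)) -(gmulA (i q')).
Qed.

End SemidirectProduct.

(** * Integral Heisenberg groups *)

Section BilinearForm.
Local Open Scope ring_scope.
Variables (n : nat) (B : 'M[int]_n).
Implicit Types a b : 'rV[int]_n.

Definition bform a b : int := (a *m B *m b^T) 0 0.

Lemma bform_is_bilinear : bilinear_for
  (GRing.Scale.Law.clone _ _ *%R _) (GRing.Scale.Law.clone _ _ *%R _) bform.
Proof.
split=> [b|a] k v w; rewrite /bform.
  by rewrite !mulmxDl -!scalemxAl !mxE.
by rewrite linearP mulmxDr -scalemxAr !mxE.
Qed.

HB.instance Definition _ := bilinear_isBilinear.Build int 'rV[int]_n 'rV[int]_n int _ _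
  bform bform_is_bilinear.

Lemma bform_delta i j : bform (delta_mx 0 i) (delta_mx 0 j) = B i j.
Proof. by rewrite /bform -rowE trmx_delta -colE !mxE. Qed.

Record heis := Heis { hx : 'rV[int]_n; hy : 'rV[int]_n; hz : int }.

Definition heis_mul h k := Heis (hx h + hx k) (hy h + hy k) (hz h + hz k - bform (hx k) (hy h)).
Definition heis_one := Heis 0 0 0.
Definition heis_inv h := Heis (- hx h) (- hy h) (- hz h - bform (hx h) (hy h)).

Lemma heis_mulA h k l : heis_mul h (heis_mul k l) = heis_mul (heis_mul h k) l.
Proof. by congr Heis; rewrite /= ?addrA // linearDl linearDr; ring. Qed.

Lemma heis_mul1 h : heis_mul heis_one h = h.
Proof. by case: h => a b c; congr Heis; rewrite /= ?add0r // linear0r subr0. Qed.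

Lemma heis_mulV h : heis_mul (heis_inv h) h = heis_one.
Proof. by congr Heis; rewrite /= ?addNr // linearNr; ring. Qed.

Definition HeisGroup : agroup := AGroup heis_mulA heis_mul1 heis_mulV.

Definition heisg a b c : HeisGroup := Heis a b c.

Lemma heisgM a b c a' b' c' :
  heisg a b c ** heisg a' b' c' = heisg (a + a') (b + b') (c + c' - bform a' b).
Proof. by []. Qed.

Lemma heis_x_hom : @ghom (ZmodGroup 'rV[int]_n) HeisGroup (fun a => heisg a 0 0).
Proof. by move=> a a'; rewrite heisgM linear0r subr0 !addr0. Qed.

Lemma heis_y_hom : @ghom (ZmodGroup 'rV[int]_n) HeisGroup (fun b => heisg 0 b 0).
Proof. by move=> b b'; rewrite heisgM linear0l subr0 !addr0. Qed.

Lemma heis_z_hom : @ghom (ZmodGroup int) HeisGroup (fun c => heisg 0 0 c).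
Proof. by move=> c c'; rewrite heisgM linear0l subr0 !addr0. Qed.

Lemma heisg_xyz a b c : heisg a b c = heisg a 0 0 ** heisg 0 b 0 ** heisg 0 0 c.
Proof. by rewrite !heisgM !linear0l !subr0 !addr0 !add0r. Qed.

Lemma heis_z_central c : central (heisg 0 0 c).
Proof.
by case=> a b c'; rewrite -[Heis _ _ _]/(heisg a b c') !heisgM linear0l linear0r !subr0
  !addr0 !add0r addrC.
Qed.

Lemma heis_z_gpow m : gpow (heisg 0 0 1) m = heisg 0 0 m.
Proof. by rewrite -(ghom_mulrz heis_z_hom) intz. Qed.

Lemma heis_gcomm_xy a b : gcomm (heisg a 0 0) (heisg 0 b 0) = heisg 0 0 (bform a b).
Proof. by apply/gcommP; rewrite !heisgM !linear0l !subr0 !addr0 !add0r addNr. Qed.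

End BilinearForm.
Arguments heisg {n B}.

Section HeisenbergFamilies.
Local Open Scope ring_scope.
Variables (G : agroup) (n : nat) (X Y : 'I_n -> G) (Z : G) (B : 'M[int]_n).
Hypothesis XX : forall i j, gcommute (X i) (X j).
Hypothesis YY : forall i j, gcommute (Y i) (Y j).
Hypothesis XZ : forall i, gcommute Z (X i).
Hypothesis YZ : forall i, gcommute Z (Y i).
Hypothesis XY : forall i j, gcomm (X i) (Y j) = gpow Z (B i j).

Let gprodz_gpow_hom (W : 'I_n -> G) (l : 'rV[int]_n -> int) :
  (forall i j, gcommute (W i) (W j)) -> (forall i, gcommute Z (W i)) ->
  {morph l : v w / v + w} ->
  @ghom (ZmodGroup 'rV[int]_n) G (fun v => gprodz W v ** gpow Z (l v)).
Proof.
move=> WW ZW lD v w; rewrite (gprodz_hom WW v w) lD gpowD.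
rewrite -!gmulA; congr (_ ** _); rewrite !gmulA; congr (_ ** _).
by apply/gcommute_gpow/gcommuteC/gcommute_gprodz.
Qed.

Lemma gcomm_gprodz a b : gcomm (gprodz X a) (gprodz Y b) = gpow Z (bform B a b).
Proof.
have conj_X i b' : gconj (gprodz Y b') (X i) = gprodz Y b' ** gpow Z (bform B (- delta_mx 0 i) b').
  move: b'; apply: ghom_rV_eq => [||j].
  - exact: ghom_comp (@gconj_hom _ _) (gprodz_hom YY).
  - exact/gprodz_gpow_hom/linearDr.
  rewrite gprodz_delta linearNl /= bform_delta gpowN -XY; apply/gconjP.
  by rewrite gmulA (gcommC (X i)) gmulK.
apply/gcommP; rewrite gconjE -gmulA; congr (_ ** _).
move: a; apply: ghom_rV_eq => [||i].
- exact: ghom_comp (@gconj_hom _ _) (gprodz_hom XX).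
- by apply: gprodz_gpow_hom => // v w; rewrite linearDl.
rewrite gprodz_delta; apply/gconjP; rewrite gmulA; move/gconjP: (conj_X i b) => ->.
by rewrite linearNl gpowN !gmulA gmulVK.
Qed.

Definition heis_eval (h : heis n) : G :=
  gprodz X (hx h) ** gprodz Y (hy h) ** gpow Z (hz h).

Lemma heis_eval_hom : @ghom (HeisGroup B) G heis_eval.
Proof.
case=> a b c [a' b' c']; rewrite /heis_eval /=.
have Zx c1 a1 : gcommute (gprodz X a1) (gpow Z c1).
  exact/gcommute_gpow/gcommuteC/gcommute_gprodz.
have Zy c1 b1 : gcommute (gprodz Y b1) (gpow Z c1).
  exact/gcommute_gpow/gcommuteC/gcommute_gprodz.
have yx : gprodz Y b ** gprodz X a'
    = gprodz X a' ** gprodz Y b ** gpow Z (- bform B a' b).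
  by rewrite (gcommC (gprodz X a')) gcomm_gprodz -gmulA -gpowD subrr gmulr1.
rewrite [gprodz X (a + a')](gprodz_hom XX) [gprodz Y (b + b')](gprodz_hom YY).
rewrite -!gmulA; congr (_ ** _); rewrite (gmulA (gpow Z c)) -Zx -gmulA.
rewrite (gmulA (gpow Z c)) -Zy -gmulA -gpowD (gmulA _ (gprodz X a')) yx -!gmulA.
do 2!congr (_ ** _); rewrite (gmulA (gpow Z _)) -Zy -gmulA -gpowD.
by congr (_ ** gpow Z _); ring.
Qed.

Lemma heis_eval_x a : heis_eval (heisg a 0 0 : HeisGroup B) = gprodz X a.
Proof. by rewrite /heis_eval /= gprodz0 !gmulr1. Qed.

Lemma heis_eval_y b : heis_eval (heisg 0 b 0 : HeisGroup B) = gprodz Y b.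
Proof. by rewrite /heis_eval /= gprodz0 gmul1 gmulr1. Qed.

Lemma heis_eval_z : heis_eval (heisg 0 0 1 : HeisGroup B) = Z.
Proof. by rewrite /heis_eval /= !gprodz0 !gmul1. Qed.

End HeisenbergFamilies.

(** * Integer vectors with coordinate sum zero *)

Section CoordinateSum.
Local Open Scope ring_scope.
Variable n : nat.
Implicit Types a b : 'rV[int]_n.

Definition coord_sum a : int := \sum_i a 0 i.

Lemma coord_sum_is_scalar : scalar coord_sum.
Proof.
by move=> k a b; rewrite /coord_sum mulr_sumr -big_split; apply: eq_bigr => i _; rewrite !mxE.
Qed.

HB.instance Definition _ := GRing.isLinear.Build int 'rV[int]_n int _
  coord_sum coord_sum_is_scalar.

Lemma coord_sum_delta i : coord_sum (delta_mx 0 i) = 1.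
Proof. by rewrite /coord_sum (big_only1 i) // => [|j ji _]; rewrite mxE ?eqxx // (negPf ji). Qed.

Lemma row_permE (s : {perm 'I_n}) a i : (a *m perm_mx s) 0 (s i) = a 0 i.
Proof.
have -> : perm_mx s = perm_mx (s^-1)^-1 by rewrite invgK.
by rewrite -col_permE mxE permK.
Qed.

Lemma delta_perm (s : {perm 'I_n}) i : delta_mx 0 i *m perm_mx s = delta_mx 0 (s i) :> 'rV[int]_n.
Proof. by rewrite -rowE; apply/rowP => j; rewrite !mxE eqxx eq_sym. Qed.

Lemma coord_sum_perm (s : {perm 'I_n}) a : coord_sum (a *m perm_mx s) = coord_sum a.
Proof.
by rewrite /coord_sum (reindex_inj (@perm_inj _ s)); apply: eq_bigr => i _; rewrite row_permE.
Qed.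

Definition dvec (p q : 'I_n) : 'rV[int]_n := delta_mx 0 q - delta_mx 0 p.

Lemma dvecE p q i : dvec p q 0 i = (i == q)%:R - (i == p)%:R.
Proof. by rewrite !mxE. Qed.

Lemma dvec_perm (s : {perm 'I_n}) p q : dvec p q *m perm_mx s = dvec (s p) (s q).
Proof. by rewrite mulmxBl !delta_perm. Qed.

Lemma coord_sum_dvec p q : coord_sum (dvec p q) = 0.
Proof. by rewrite raddfB /= !coord_sum_delta subrr. Qed.

Lemma row_tperm a p q : a *m perm_mx (tperm p q) = a - (a 0 q - a 0 p) *: dvec p q.
Proof.
apply/rowP=> k; rewrite -{1}[k](tpermK p q) row_permE !mxE.
case: tpermP => [->|->|/eqP/negPf-> /eqP/negPf->]; rewrite ?eqxx; last by ring.
  by case: eqVneq => [->|_] /=; ring.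
by case: eqVneq => [->|_] /=; ring.
Qed.

Lemma bform1_perm (s : {perm 'I_n}) a b :
  bform 1%:M (a *m perm_mx s) (b *m perm_mx s) = bform 1%:M a b.
Proof.
by rewrite /bform !mulmx1 trmx_mul mulmxA -(mulmxA a) tr_perm_mx -perm_mxM mulgV perm_mx1 mulmx1.
Qed.

Lemma bform1_dvec a p q : bform 1%:M a (dvec p q) = a 0 q - a 0 p.
Proof. by rewrite /dvec linearBr /= /bform !mulmx1 !trmx_delta -!colE !mxE. Qed.

Lemma bform1_dvecl a p q : bform 1%:M (dvec p q) a = a 0 q - a 0 p.
Proof. by rewrite /dvec linearBl /= /bform !mulmx1 -!rowE !mxE. Qed.

End CoordinateSum.

Section BasedDecomposition.
Local Open Scope ring_scope.
Variable n : nat.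
Implicit Types a b : 'rV[int]_n.+1.

Definition base_mx : 'M[int]_n.+1 := \matrix_i dvec ord0 i.

Lemma mul_base_mx a : coord_sum a = 0 -> a *m base_mx = a.
Proof.
move=> a0; rewrite mulmx_sum_row; under eq_bigr => i _ do rewrite rowK scalerBr.
by rewrite sumrB -row_sum_delta -scaler_suml [X in X *: _]a0 scale0r subr0.
Qed.

Definition base_form : 'M[int]_n.+1 := base_mx *m base_mx^T.

Lemma bform_base_form a b : coord_sum a = 0 -> coord_sum b = 0 ->
  bform base_form a b = bform 1%:M a b.
Proof.
move=> a0 b0; rewrite /bform mulmx1 /base_form mulmxA mul_base_mx // -mulmxA.
by rewrite -trmx_mul mul_base_mx.
Qed.

Lemma base_formE i j : base_form i j = bform 1%:M (dvec ord0 i) (dvec ord0 j).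
Proof. by rewrite -bform_delta /bform /base_form mulmx1 mulmxA -mulmxA -trmx_mul -!rowE !rowK. Qed.

Lemma sum0_ind (P : 'rV[int]_n.+1 -> Prop) : (forall a b, P a -> P b -> P (a + b)) ->
  (forall i k, P (k *: dvec ord0 i)) -> forall a, coord_sum a = 0 -> P a.
Proof.
move=> PD Pd a /mul_base_mx <-; rewrite mulmx_sum_row.
elim/big_ind: _ => [|b c|i _]; [by rewrite -(scale0r (dvec ord0 ord0)) | exact: PD |].
by rewrite rowK.
Qed.

Lemma ghom_sum0_eq (G : agroup) (f g : ZmodGroup 'rV[int]_n.+1 -> G) : ghom f -> ghom g ->
  (forall i, f (dvec ord0 i) = g (dvec ord0 i)) -> forall a, coord_sum a = 0 -> f a = g a.
Proof.
move=> fM gM fg; apply: sum0_ind => [a b fa fb|i k]; first by rewrite (fM a b) fa fb (gM a b).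
by rewrite -[k]intz scaler_int !ghom_mulrz ?fg.
Qed.

Lemma subgroup_hom_sum0 (G : agroup) (P : G -> Prop) (f : ZmodGroup 'rV[int]_n.+1 -> G) :
  subgroup P -> ghom f -> (forall i, P (f (dvec ord0 i))) -> forall a, coord_sum a = 0 -> P (f a).
Proof.
move=> sP fM Pf; apply: sum0_ind => [a b|i k]; first by rewrite (fM a b); case: sP => _ + _; apply.
by rewrite -[k]intz scaler_int ghom_mulrz //; apply: subgroup_gpow.
Qed.

Lemma sum0_perm_invariant_eq0 a : coord_sum a = 0 ->
  (forall p q, a *m perm_mx (tperm p q) = a) -> a = 0.
Proof.
move=> a0 aJ; have aE i : a 0 i = a 0 ord0.
  by have := row_permE (tperm i ord0) a ord0; rewrite tpermR aJ.
have {}a0 : a 0 ord0 = 0.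
  move: a0; rewrite /coord_sum (eq_bigr _ (fun i _ => aE i)) sumr_const card_ord.
  by move/eqP; rewrite Num.Theory.mulrn_eq0 => /eqP.
by apply/rowP=> i; rewrite aE a0 mxE.
Qed.

Lemma sum0_col'_eq0 a : coord_sum a = 0 -> col' ord0 a = 0 -> a = 0.
Proof.
move=> a0 /rowP al; have {}al i : i != ord0 -> a 0 i = 0.
  by case: (unliftP ord0 i) => [j ->|->] _ //; have := al j; rewrite !mxE.
have {}a0 : a 0 ord0 = 0.
  by rewrite -a0 /coord_sum (big_only1 ord0) // => i /al.
by apply/rowP=> i; rewrite mxE; have [->|/al] := eqVneq i ord0.
Qed.

Lemma sum0_col'_surj (b : 'rV[int]_n) : exists2 a, coord_sum a = 0 & col' ord0 a = b.
Proof.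
exists (\row_i (if unlift ord0 i is Some j then b 0 j else - coord_sum b)).
  rewrite [LHS]big_ord_recl mxE unlift_none -[RHS](addNr (coord_sum b)); congr (_ + _).
  by apply: eq_bigr => j _; rewrite mxE liftK.
by apply/rowP=> j; rewrite !mxE liftK.
Qed.

End BasedDecomposition.

(** * Permutations acting on the Heisenberg group, and reflections *)

Section SymHeis.
Local Open Scope ring_scope.
Variable n : nat.
Notation Sym := (SymGroup 'I_n).
Notation Hs := (HeisGroup (1%:M : 'M[int]_n)).

Definition heis_perm (s : Sym) (h : Hs) : Hs :=
  heisg (hx h *m perm_mx s) (hy h *m perm_mx s) (hz h).

Lemma heis_perm_hom s : ghom (heis_perm s).
Proof. by move=> h k; congr Heis; rewrite /= ?mulmxDl // bform1_perm. Qed.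

Lemma heis_perm1 h : heis_perm gone h = h.
Proof. by case: h => a b c; rewrite /heis_perm perm_mx1 !mulmx1. Qed.

Lemma heis_perm_comp s t h : heis_perm (s ** t) h = heis_perm t (heis_perm s h).
Proof. by rewrite /heis_perm perm_mxM !mulmxA. Qed.

Definition SymHeis : agroup := sdprod_agroup heis_perm_hom heis_perm1 heis_perm_comp.

Definition slift : Sym -> SymHeis := sdl heis_perm_hom heis_perm1 heis_perm_comp.
Definition sheis : Hs -> SymHeis := sdr heis_perm_hom heis_perm1 heis_perm_comp.

Lemma slift_hom : ghom slift.
Proof. exact: sdlM. Qed.

Lemma sheis_hom : ghom sheis.
Proof. exact: sdrM. Qed.

Lemma symheisE (m : SymHeis) : m = slift m.1 ** sheis m.2.
Proof. exact: sdE. Qed.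

Lemma sheis_conj s h : gconj (sheis h) (slift s) = sheis (heis_perm s h).
Proof. exact: sdr_conj. Qed.

Lemma symheisM (m m' : SymHeis) : m ** m' = (m.1 ** m'.1, heis_perm m'.1 m.2 ** m'.2) :> SymHeis.
Proof. by []. Qed.

Lemma sheis_z_central c : central (sheis (heisg 0 0 c)).
Proof.
move=> m; rewrite (symheisE m); apply: gcommuteM.
  by apply/gcommute_gconjP; rewrite sheis_conj /heis_perm /= !mul0mx.
by rewrite /gcommute -!sheis_hom heis_z_central.
Qed.

(* The central coordinate is forced: it is the only one for which the element squares to 1. *)
Definition srefl (p q : 'I_n) (v : int * int) : SymHeis :=
  (tperm p q, heisg (v.1 *: dvec p q) (v.2 *: dvec p q) (- (v.1 * v.2))).

Lemma sreflE p q v : srefl p q v =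
  slift (tperm p q) ** sheis (heisg (v.1 *: dvec p q) (v.2 *: dvec p q) (- (v.1 * v.2))).
Proof. exact: symheisE. Qed.

Lemma srefl0 p q : srefl p q 0 = slift (tperm p q).
Proof. by rewrite /srefl /= !scale0r mul0r oppr0. Qed.

Lemma sreflC p q v : srefl p q v = srefl q p (- v).
Proof.
have d : dvec q p = - dvec p q by rewrite opprB.
by rewrite /srefl tpermC d /= !scalerN !scaleNr mulrNN !opprK.
Qed.

Lemma slift_tperm_conj p q a b c :
  gconj (slift (tperm p q)) (sheis (heisg a b c)) = srefl p q (a 0 q - a 0 p, b 0 q - b 0 p).
Proof.
apply/gconjP; rewrite -[LHS](symheisE (tperm p q, heisg a b c)) symheisM.
congr pair; first by rewrite gmul1.
have bp := row_permE (tperm p q) b p; have bq := row_permE (tperm p q) b q.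
rewrite tpermL in bp; rewrite tpermR in bq.
rewrite [RHS]heisgM /= linearZl_LR /= bform1_dvecl bp bq !row_tperm !subrK.
by congr heisg; ring.
Qed.

(* Every reflection is conjugate to a transposition by an element of the Heisenberg
   group, so that the relations between reflections follow from those of [Sym]. *)
Lemma sreflJ p q v : p != q ->
  srefl p q v = gconj (slift (tperm p q))
    (sheis (heisg (v.1 *: delta_mx 0 q) (v.2 *: delta_mx 0 q) 0)).
Proof.
move=> pq; rewrite slift_tperm_conj !mxE !eqxx (negPf pq) !mulr1 !mulr0 !subr0.
by case: v.
Qed.

Lemma srefl_sq p q v : p != q -> srefl p q v ** srefl p q v = gone.
Proof.
move=> pq; rewrite sreflJ // -gconjM -slift_hom.
have -> : (tperm p q : Sym) ** tperm p q = gone by exact: tperm2.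
by rewrite (ghom1 slift_hom) gconj1.
Qed.

Lemma srefl_slift_conj p q v s : p != q ->
  gconj (srefl p q v) (slift s) = srefl (s p) (s q) v.
Proof.
move=> pq; rewrite !sreflJ ?(inj_eq perm_inj) // gconjJ sheis_conj.
by rewrite -(ghom_gconj slift_hom) symgroupJ tpermJ /heis_perm /= -!scalemxAl !delta_perm.
Qed.

Definition sheet_shift (r s : 'I_n) (w : int * int) (x : 'I_n) : int * int :=
  w *+ (x == r) - w *+ (x == s).

Lemma srefl_conj p q v r s w : p != q ->
  gconj (srefl p q v) (srefl r s w)
  = srefl (tperm r s p) (tperm r s q) (v + sheet_shift r s w q - sheet_shift r s w p).
Proof.
move=> pq; rewrite (sreflE r s) gconjMr srefl_slift_conj // sreflJ ?(inj_eq perm_inj) //.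
rewrite -gconjMr -sheis_hom slift_tperm_conj !mxE !eqxx.
have sE x y : (tperm r s x == y) = (x == tperm r s y).
  by rewrite (can2_eq (tpermK r s) (tpermK r s)).
rewrite !sE !tpermK (negPf pq) tpermL tpermR.
rewrite /sheet_shift; case: v w => v1 v2 [w1 w2]; congr srefl.
by apply: injective_projections => /=; do 4!case: eqP => _; rewrite /= ?mulr1n ?mulr0n; ring.
Qed.

Lemma slift_tperm_srefl p q v :
  slift (tperm p q) ** srefl p q v
  = sheis (heisg (v.1 *: dvec p q) (v.2 *: dvec p q) (- (v.1 * v.2))).
Proof.
rewrite sreflE gmulA -slift_hom; have -> : (tperm p q : Sym) ** tperm p q = gone by exact: tperm2.
by rewrite (ghom1 slift_hom) gmul1.
Qed.

Definition balanced (h : heis n) : Prop := coord_sum (hx h) = 0 /\ coord_sum (hy h) = 0.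

Lemma balanced_perm s h : balanced h -> balanced (heis_perm s h).
Proof. by case=> x0 y0; split; rewrite coord_sum_perm. Qed.

Lemma coord_sum_x_hom : @ghom SymHeis (ZmodGroup int) (fun m => coord_sum (hx m.2)).
Proof. by move=> m m'; rewrite symheisM /= raddfD /= coord_sum_perm. Qed.

Lemma coord_sum_y_hom : @ghom SymHeis (ZmodGroup int) (fun m => coord_sum (hy m.2)).
Proof. by move=> m m'; rewrite symheisM /= raddfD /= coord_sum_perm. Qed.

Lemma balancedM (m m' : SymHeis) : balanced m.2 -> balanced m'.2 -> balanced (m ** m').2.
Proof.
move=> [x0 y0] [x0' y0']; split.
  by have := coord_sum_x_hom m m'; rewrite /gmul /= x0 x0' => ->.
by have := coord_sum_y_hom m m'; rewrite /gmul /= y0 y0' => ->.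
Qed.

Lemma balanced_srefl p q v : balanced (srefl p q v).2.
Proof. by split; rewrite linearZ /= coord_sum_dvec mulr0. Qed.

End SymHeis.

Section BalancedSymHeis.
Local Open Scope ring_scope.
Variable n : nat.
Hypothesis n_gt1 : (1 < n)%N.
Notation SH := (SymHeis n.+1).
Notation Hs := (HeisGroup (1%:M : 'M[int]_n.+1)).

Lemma balanced_heis_min (P : Hs -> Prop) : subgroup P ->
  (forall p q, P (heisg (dvec p q) 0 0)) -> (forall p q, P (heisg 0 (dvec p q) 0)) ->
  forall h, balanced h -> P h.
Proof.
move=> sP Px Py [a b c] [/= a0 b0]; have [_ PM _] := sP.
rewrite -[Heis a b c]/(heisg a b c : Hs) heisg_xyz; apply/PM; first apply/PM.
- exact: (subgroup_hom_sum0 sP (heis_x_hom _)).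
- exact: (subgroup_hom_sum0 sP (heis_y_hom _)).
rewrite -heis_z_gpow; apply: subgroup_gpow => //.
have <- : gcomm (heisg (dvec ord0 (inord 1)) 0 0) (heisg 0 (dvec ord0 (inord 2)) 0)
    = heisg 0 0 1 :> Hs.
  rewrite heis_gcomm_xy bform1_dvec !dvecE -!val_eqE /= !inordK // !ltnS ltnW //.
by apply: subgroup_gcomm.
Qed.

Lemma balanced_min (P : SH -> Prop) : subgroup P -> (forall s, P (slift s)) ->
  (forall p q, p != q -> P (srefl p q (1, 0))) -> (forall p q, p != q -> P (srefl p q (0, 1))) ->
  forall m : SH, balanced m.2 -> P m.
Proof.
move=> sP Ps P10 P01 m bm; have [P1 PM _] := sP.
rewrite (symheisE m); apply/PM => //.
apply: (@balanced_heis_min (fun h => P (sheis h))) bm => [|p q|p q].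
- exact: (subgroup_preimage (@sheis_hom _) sP).
- have [->|pq] := eqVneq p q; first by rewrite /dvec subrr; exact: P1.
  have := slift_tperm_srefl p q (1, 0); rewrite /= scale1r scale0r mulr0 oppr0 => <-.
  by apply/PM => //; apply: P10.
- have [->|pq] := eqVneq p q; first by rewrite /dvec subrr; exact: P1.
  have := slift_tperm_srefl p q (0, 1); rewrite /= scale1r scale0r mul0r oppr0 => <-.
  by apply/PM => //; apply: P01.
Qed.

Definition heis_coords (h : Hs) : ZmodGroup 'rV[int]_(n + n) :=
  row_mx (col' ord0 (hx h)) (col' ord0 (hy h)).

Lemma heis_coords_hom : ghom heis_coords.
Proof. by move=> h k; rewrite [RHS]add_row_mx /heis_coords /= !linearD. Qed.

Lemma heis_coords_surj v : exists2 h, balanced h & heis_coords h = v.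
Proof.
have [a a0 av] := sum0_col'_surj (lsubmx v); have [b b0 bv] := sum0_col'_surj (rsubmx v).
by exists (heisg a b 0 : Hs); rewrite // /heis_coords /= av bv hsubmxK.
Qed.

Lemma heis_coords_eq1 h : balanced h -> heis_coords h = gone <-> exists c, h = heisg 0 0 c :> Hs.
Proof.
case: h => a b c [/= a0 b0]; split=> [hE|[c' [-> -> _]]]; last first.
  by rewrite /heis_coords /= !linear0 row_mx0.
exists c; rewrite /heisg; congr Heis; apply: sum0_col'_eq0 => //.
  by have := congr1 lsubmx hE; rewrite row_mxKl linear0.
by have := congr1 rsubmx hE; rewrite row_mxKr linear0.
Qed.

Lemma symheis_central_eq (m : SH) : balanced m.2 -> (forall s, gcommute m (slift s)) ->
  exists c, m = sheis (heisg 0 0 c).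
Proof.
move=> bm cm; have m1 : m.1 = gone.
  apply/permP => i; rewrite perm1; apply/eqP/negPn/negP => mi.
  have [|k] := @exists_notin _ [:: i; m.1 i]; first by rewrite card_ord.
  rewrite !inE negb_or => /andP[ki km].
  pose t : SymGroup 'I_n.+1 := tperm (m.1 i) k.
  have /permP/(_ i) : m.1 ** t = t ** m.1 := congr1 fst (cm t).
  by rewrite !symgroupM tpermL tpermD // => kmi; rewrite kmi eqxx in km.
have mE : m = sheis m.2 by rewrite [LHS]symheisE m1 (ghom1 (@slift_hom _)) gmul1.
have hJ t : heis_perm t m.2 = m.2.
  by have /gcommute_gconjP := cm t; rewrite mE sheis_conj => -[].
rewrite mE; case: m.2 bm hJ => a b c [/= a0 b0] hJ; exists c.
have az : a = 0 by apply: (sum0_perm_invariant_eq0 a0) => p q; have [] := hJ (tperm p q).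
have bz : b = 0 by apply: (sum0_perm_invariant_eq0 b0) => p q; have [] := hJ (tperm p q).
by rewrite az bz.
Qed.

End BalancedSymHeis.

(** * Groups over the symmetric group: equivariant families of involutions *)

Section ReflectionFamilies.
Variables (T : finType) (G : agroup) (iota : SymGroup T -> G).
Hypothesis iotaM : ghom iota.
Implicit Types (p q r : T) (s : SymGroup T) (A : T -> T -> G).

Definition tau p q : G := iota (tperm p q).

Lemma tauC p q : tau p q = tau q p.
Proof. by rewrite /tau tpermC. Qed.

Lemma tau_sq p q : tau p q ** tau p q = gone.
Proof. by rewrite /tau -iotaM -(ghom1 iotaM); congr iota; apply: tperm2. Qed.

Lemma tau_conj p q s : gconj (tau p q) (iota s) = tau (s p) (s q).
Proof. by rewrite /tau -(ghom_gconj iotaM) symgroupJ tpermJ. Qed.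

Definition refl_family A : Prop :=
  [/\ forall s p q, p != q -> gconj (A p q) (iota s) = A (s p) (s q),
      forall p q, p != q -> A p q ** A p q = gone,
      forall p q r, uniq [:: p; q; r] -> braid (A p q) (tau q r) &
      forall p q r, uniq [:: p; q; r] -> braid (A p q) (tau p r)].

Lemma tau_conj_refl A p q r : refl_family A -> uniq [:: p; q; r] ->
  gconj (tau q r) (A p q) = A p r /\ gconj (tau p r) (A p q) = A r q.
Proof.
case=> AJ Asq Aq Ap u; have pq : p != q by distinct.
have /braid_involutionP Aq' := Aq _ _ _ u; have /braid_involutionP Ap' := Ap _ _ _ u.
rewrite -Aq' -?Ap' ?Asq ?tau_sq // !AJ // !tpermL !tpermD //; distinct.
Qed.

Section Orbit.
Variables (w : G) (p0 q0 : T).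
Hypothesis pq0 : p0 != q0.
Hypothesis w_fix : forall s, s p0 = p0 -> s q0 = q0 -> gcommute w (iota s).

Definition carrier_perm p q : SymGroup T := (tperm p0 p * tperm (tperm p0 p q0) q)%g.

Lemma carrier_permP p q : p != q -> carrier_perm p q p0 = p /\ carrier_perm p q q0 = q.
Proof.
move=> pq; rewrite !permM tpermL tpermL tpermD //; last by rewrite eq_sym.
by rewrite -[X in _ != X](tpermL p0) (inj_eq perm_inj) eq_sym.
Qed.

Definition orbit_family p q : G := gconj w (iota (carrier_perm p q)).

Lemma orbit_familyE s : gconj w (iota s) = orbit_family (s p0) (s q0).
Proof.
have pq : s p0 != s q0 by rewrite (inj_eq perm_inj).
have := carrier_permP pq; rewrite /orbit_family; set c := carrier_perm _ _ => -[cp cq].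
rewrite -[in LHS](gmulVK s c) iotaM gconjMr; congr gconj.
by apply/gcommute_gconjP/w_fix; rewrite symgroupM; apply: (canLR (permK _)).
Qed.

Lemma orbit_family0 : orbit_family p0 q0 = w.
Proof.
by have := orbit_familyE gone; rewrite !perm1 (ghom1 iotaM) gconj1r.
Qed.

Lemma orbit_refl_family r1 r2 : uniq [:: p0; q0; r1] -> uniq [:: p0; q0; r2] ->
  w ** w = gone -> braid w (tau q0 r1) -> braid w (tau p0 r2) -> refl_family orbit_family.
Proof.
move=> u1 u2 ww br1 br2; split=> [s p q pq|p q _|p q r u|p q r u].
- have [cp cq] := carrier_permP pq.
  by rewrite -gconjMr -iotaM (orbit_familyE (_ ** s)) !(symgroupM (carrier_perm _ _)) cp cq.
- by rewrite /orbit_family -gconjM ww gconj1.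
- have [f [<- <- <-]] := perm_map_exists u1 u erefl.
  by rewrite -orbit_familyE -tau_conj; apply: braid_gconj.
- have [f [<- <- <-]] := perm_map_exists u2 u erefl.
  by rewrite -orbit_familyE -tau_conj; apply: braid_gconj.
Qed.

End Orbit.

(** * Translations and their commutators *)

Definition shift A p q : G := if p == q then gone else tau p q ** A p q.

Section OneFamily.
Variable A : T -> T -> G.
Hypothesis Afam : refl_family A.
Notation X := (shift A).

Lemma shift_id p : X p p = gone.
Proof. by rewrite /shift eqxx. Qed.

Lemma shiftE p q : p != q -> X p q = tau p q ** A p q.
Proof. by rewrite /shift => /negPf ->. Qed.

Lemma refl_shift p q : p != q -> A p q = tau p q ** X p q.
Proof. by move=> pq; rewrite shiftE // gmulA tau_sq gmul1. Qed.

Lemma shift_conj p q s : gconj (X p q) (iota s) = X (s p) (s q).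
Proof.
case: Afam => AJ _ _ _; rewrite /shift (inj_eq perm_inj).
by case: eqVneq => [_|pq]; rewrite ?gconj1 // gconjM tau_conj AJ.
Qed.

Lemma shift_tau p q r r' : gconj (X p q) (tau r r') = X (tperm r r' p) (tperm r r' q).
Proof. exact: shift_conj. Qed.

Lemma shiftV p q : ginv (X p q) = X q p.
Proof.
case: Afam => _ Asq _ _; have [->|pq] := eqVneq p q; first by rewrite shift_id ginv1.
have := shift_tau p q p q; rewrite tpermL tpermR => <-.
rewrite (shiftE pq); apply: ginv_eq; rewrite gconjM gconj_id gconj_involution ?tau_sq //.
rewrite !gmulA -(gmulA _ (tau p q) (tau p q)) tau_sq gmulr1.
by rewrite -(gmulA _ (A p q) (A p q)) Asq // gmulr1 tau_sq.
Qed.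

Lemma shift_mul_neq p q r : uniq [:: p; q; r] ->
  X q r ** X p q = X p r /\ X p r ** X r q = X p q.
Proof.
move=> u; have pq : p != q by distinct.
have prn : p != r by distinct.
have rqn : r != q by distinct.
have [A_pr A_rq] := tau_conj_refl Afam u.
have conjA a : gconj a (A p q) = gconj (gconj a (tau p q)) (X p q).
  by rewrite -gconjMr -refl_shift.
have mul_conj t a : t ** t = gone -> t ** gconj t a = ginv (gconj a t) ** a.
  by move=> tt; rewrite -gconjV (gconj_involution _ tt) /gconj !gmulA.
have X_pr : X p r = ginv (gconj (X p q) (tau p r)) ** X p q.
  rewrite shiftE // -A_pr conjA tau_conj tpermR tpermD; try distinct.
  exact: mul_conj (tau_sq p r).
have X_rq : X r q = ginv (gconj (X p q) (tau r q)) ** X p q.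
  rewrite shiftE // -A_rq conjA tau_conj tpermL tpermD; try distinct.
  by rewrite [tau q r]tauC; apply: mul_conj (tau_sq r q).
split; first by rewrite X_pr shift_tau tpermL tpermD ?shiftV //; distinct.
by rewrite X_rq shift_tau tpermR tpermD ?gmulVKl //; distinct.
Qed.

Lemma shift_trans p q r : X p q ** X q r = X p r.
Proof.
have [->|pq] := eqVneq p q; first by rewrite shift_id gmul1.
have [->|qr] := eqVneq q r; first by rewrite shift_id gmulr1.
have [<-|pr] := eqVneq p r; first by rewrite -(shiftV p q) gmulrV shift_id.
by have [|_ ->] := @shift_mul_neq p r q; first by distinct.
Qed.

Lemma shift_commute p q r r' : gcommute (X p q) (X r r').
Proof.
have tr a b c : gcommute (X a b) (X b c).
  have [->|ab] := eqVneq a b; first by rewrite shift_id; apply/gcommuteC/gcommute1.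
  have [->|bc] := eqVneq b c; first by rewrite shift_id; apply/gcommute1.
  have [<-|ac] := eqVneq a c; first by rewrite /gcommute !shift_trans !shift_id.
  have [|bcab _] := @shift_mul_neq a b c; first by distinct.
  by rewrite /gcommute shift_trans.
rewrite -(shift_trans r p r'); apply: gcommuteM; first exact/gcommuteC/tr.
by rewrite -(shiftV q p); apply/gcommuteC/gcommuteV/gcommuteC/tr.
Qed.

End OneFamily.

Definition commuting_families A B : Prop :=
  forall p q r r', uniq [:: p; q; r; r'] -> gcommute (A p q) (B r r').

Definition exchanging_families A B : Prop :=
  forall p q r r', uniq [:: p; q; r; r'] -> gconj (B p r) (A p q) = gconj (B q r') (A r r').

Section TwoFamilies.
Variables A B : T -> T -> G.
Hypotheses (Afam : refl_family A) (Bfam : refl_family B).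
Hypotheses (AB_commute : commuting_families A B) (AB_exchange : exchanging_families A B).
Notation X := (shift A).
Notation Y := (shift B).

Lemma shifts_commute p q r r' : uniq [:: p; q; r; r'] -> gcommute (X p q) (Y r r').
Proof.
move=> u; have [[AJ _ _ _] [BJ _ _ _]] := (Afam, Bfam).
have pq : p != q by distinct.
have rr' : r != r' by distinct.
rewrite !shiftE //; apply: gcommuteM; apply: gcommuteMl.
- by apply/gcommute_gconjP; rewrite tau_conj !tpermD //; distinct.
- by apply/gcommute_gconjP; rewrite AJ // !tpermD //; distinct.
- by apply/gcommuteC/gcommute_gconjP; rewrite BJ // !tpermD //; distinct.
- exact: AB_commute.
Qed.

Lemma shift_pair_commute p q r r' : uniq [:: p; q; r; r'] -> gcommute (X p q ** X r' r) (Y q r).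
Proof.
move=> u; have [BJ _ _ _] := Bfam.
have [pq rr' [pr qr' qr]] : [/\ p != q, r != r' & [/\ p != r, q != r' & q != r]].
  by do !split; distinct.
rewrite (shiftE B qr); apply/gcommuteC/gcommuteMl/gcommuteC/gcommute_gconjP.
  apply/gcommuteC/gcommute_gconjP; rewrite gconjM !shift_tau // tpermL tpermR !tpermD; try distinct.
  rewrite -(shift_trans Afam p q r) -(shift_trans Afam r' r q) -!gmulA; congr (_ ** _).
  rewrite (shift_commute Afam r' r r q) gmulA (shift_trans Afam) //.
  by rewrite shift_id gmul1.
have := AB_exchange u; rewrite (refl_shift A pq) (refl_shift A rr') !gconjMr !BJ // => BX.
move: BX; rewrite tpermL tpermR !tpermD; try distinct.
move=> BX; apply/gcommute_gconjP/gcommuteC/gcommute_gconjP.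
by rewrite gconjMr BX -gconjMr -(shiftV Afam r r') gmulrV gconj1r.
Qed.

Hypothesis cardT : 5 < #|T|.

Let exists_new (s : seq T) : size s < 6 -> exists k, k \notin s.
Proof. by move=> s6; apply: exists_notin; lia. Qed.

(* [zed p q r] plays the role of the commutator [x_p, y_p]. *)
Definition zed p q r : G := gcomm (X p q) (Y p r).

Lemma zed_indep p q r q' r' : uniq [:: p; q; r] -> uniq [:: p; q'; r'] -> zed p q r = zed p q' r'.
Proof.
move=> u u'.
have move_x k a b : uniq [:: p; a; b; k] -> zed p a b = zed p k b.
  move=> v; rewrite /zed -(shift_trans Afam p k a) (shift_commute Afam) gcommMl_commute //.
  by apply: shifts_commute; distinct.
have move_y k a b : uniq [:: p; a; b; k] -> zed p a b = zed p a k.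
  move=> v; rewrite /zed -(shift_trans Bfam p k b) (shift_commute Bfam) gcommMr_commute //.
  by apply: shifts_commute; distinct.
have [k] := @exists_new [:: p; q; r; q'; r'] isT => new_k.
rewrite (move_x k q r) ?(move_x k q' r'); try distinct.
by have [->//|rr'] := eqVneq r r'; apply: move_y; distinct.
Qed.

Lemma zed_commute_x p q r i j : uniq [:: p; q; r] -> i != p -> j != p ->
  gcommute (X i j) (zed p q r).
Proof.
move=> u ip jp; have [->|ij] := eqVneq i j.
  by rewrite shift_id; apply/gcommuteC/gcommute1.
have [q' new_q] := @exists_new [:: p; i; j] isT.
have [r' new_r] := @exists_new [:: p; i; j; q'] isT.
rewrite (@zed_indep p q r q' r') //; last by distinct.
apply: subgroup_gcomm; [exact: subgroup_centralizer | exact: shift_commute |].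
by apply: shifts_commute; distinct.
Qed.

Lemma zed_commute_y p q r i j : uniq [:: p; q; r] -> i != p -> j != p ->
  gcommute (Y i j) (zed p q r).
Proof.
move=> u ip jp; have [->|ij] := eqVneq i j.
  by rewrite shift_id; apply/gcommuteC/gcommute1.
have [q' new_q] := @exists_new [:: p; i; j] isT.
have [r' new_r] := @exists_new [:: p; i; j; q'] isT.
rewrite (@zed_indep p q r q' r') //; last by distinct.
apply: subgroup_gcomm; [exact: subgroup_centralizer | | exact: shift_commute].
by apply/gcommuteC/shifts_commute; distinct.
Qed.

Lemma zed_conj p q r p' q' r' : uniq [:: p; q; r] -> uniq [:: p'; q'; r'] -> p != p' ->
  zed p q r = gconj (zed p' q' r') (Y p p').
Proof.
move=> u u' pp'.
have [a new_a] := @exists_new [:: p; p'] isT.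
have [b new_b] := @exists_new [:: p; p'; a] isT.
have v : uniq [:: a; p; p'; b] by distinct.
rewrite (@zed_indep p q r a p') //; last by distinct.
rewrite (@zed_indep p' q' r' b p) //; last by distinct.
have Xpa : gconj (X p a) (Y p p') = X p a ** zed p a p' by exact: gconj_gcomm.
have Xpb : gconj (X p' b) (Y p p') = X p' b ** ginv (gconj (zed p' b p) (Y p p')).
  by rewrite gconj_gcomm -(shiftV Bfam p' p) gcommVr.
have zX : gcommute (X p' b) (zed p a p') by apply: zed_commute_x; distinct.
have : gconj (X p a ** X p' b) (Y p p') = X p a ** X p' b.
  rewrite -(shiftV Afam a p) -(shiftV Afam b p') -ginvM (shift_commute Afam) gconjV.
  by congr ginv; apply/gcommute_gconjP/shift_pair_commute.
rewrite gconjM Xpa Xpb -(gmulA (X p a)) => /gmulI.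
rewrite gmulA -zX -(gmulA (X p' b)) -[RHS]gmulr1 => /gmulI zz.
by apply: (@gmulIr _ (ginv (gconj (zed p' b p) (Y p p')))); rewrite zz gmulrV.
Qed.

Lemma zed_const p q r p' q' r' : uniq [:: p; q; r] -> uniq [:: p'; q'; r'] ->
  zed p q r = zed p' q' r'.
Proof.
move=> u u'; have [pp'|pp'] := eqVneq p p'; first by rewrite pp' in u *; exact: zed_indep.
have [k new_k] := @exists_new [:: p; p'] isT.
have w : uniq [:: k; p; p'] by distinct.
rewrite (zed_conj u w) ?(zed_conj u' w); try distinct.
rewrite -(shift_trans Bfam p p' k) gconjMr; congr gconj.
by apply/gcommute_gconjP/gcommuteC/zed_commute_y; distinct.
Qed.

Lemma zed_central_x p q r i j : uniq [:: p; q; r] -> gcommute (X i j) (zed p q r).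
Proof.
move=> u; have [k new_k] := @exists_new [:: i; j] isT.
have [a new_a] := @exists_new [:: k] isT; have [b new_b] := @exists_new [:: k; a] isT.
by rewrite (@zed_const p q r k a b) //; [apply: zed_commute_x |]; distinct.
Qed.

Lemma zed_central_y p q r i j : uniq [:: p; q; r] -> gcommute (Y i j) (zed p q r).
Proof.
move=> u; have [k new_k] := @exists_new [:: i; j] isT.
have [a new_a] := @exists_new [:: k] isT; have [b new_b] := @exists_new [:: k; a] isT.
by rewrite (@zed_const p q r k a b) //; [apply: zed_commute_y |]; distinct.
Qed.

Lemma zed_central_perm p q r s : uniq [:: p; q; r] -> gcommute (zed p q r) (iota s).
Proof.
move=> u; apply/gcommute_gconjP; rewrite /zed gconj_gcommE !shift_conj //.
by apply: zed_const => //; rewrite -[[:: _; _; _]]/(map s [:: p; q; r]) (map_inj_uniq perm_inj).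
Qed.

Lemma gcomm_shift_self p q r a b : uniq [:: p; q; r] -> a != b ->
  gcomm (X a b) (Y a b) = zed p q r ** zed p q r.
Proof.
move=> u ab; have [k new_k] := @exists_new [:: a; b] isT.
have v : uniq [:: a; k; b] by distinct.
have v' : uniq [:: b; k; a] by distinct.
have Xkb : gcomm (X k b) (Y a b) = zed p q r.
  rewrite -(shiftV Afam b k) -(shiftV Bfam b a) (zed_const u v').
  by apply: gcommVV; [apply: zed_central_x | apply: zed_central_y].
have Xak : gcomm (X a k) (Y a b) = zed p q r := zed_const v u.
rewrite -(shift_trans Afam a k b) gcommMl ?Xak ?Xkb //.
exact/gcommuteC/zed_central_x.
Qed.

End TwoFamilies.
End ReflectionFamilies.

(** * Evaluation of balanced elements of the model *)

Section BasedShifts.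
Local Open Scope ring_scope.
Variables (n : nat) (G : agroup) (iota : SymGroup 'I_n.+1 -> G).
Hypothesis iotaM : ghom iota.
Variable A : 'I_n.+1 -> 'I_n.+1 -> G.
Hypothesis Afam : refl_family iota A.
Notation X := (shift iota A).

Lemma base_shift_hom : @ghom (ZmodGroup 'rV[int]_n.+1) G (gprodz (X ord0)).
Proof. by apply: gprodz_hom => i j; apply: shift_commute. Qed.

Lemma base_shift_dvec p q : gprodz (X ord0) (dvec p q) = X p q.
Proof.
rewrite [LHS](base_shift_hom (delta_mx 0 q) (- delta_mx 0 p)).
rewrite [X in _ ** X](ghomV base_shift_hom (delta_mx 0 p)) !gprodz_delta.
by rewrite (shiftV iotaM Afam) (shift_commute iotaM Afam) (shift_trans iotaM Afam).
Qed.

Lemma base_shift_conj (s : SymGroup 'I_n.+1) a : coord_sum a = 0 ->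
  gconj (gprodz (X ord0) a) (iota s) = gprodz (X ord0) (a *m perm_mx s).
Proof.
move: a; apply: ghom_sum0_eq => [||i].
- exact: ghom_comp (@gconj_hom _ _) base_shift_hom.
- by move=> a b; rewrite -[a ** b]/(a + b)%R mulmxDl; apply: base_shift_hom.
- by rewrite dvec_perm !base_shift_dvec shift_conj.
Qed.

End BasedShifts.

Section Evaluation.
Local Open Scope ring_scope.
Variables (n : nat) (G : agroup) (iota : SymGroup 'I_n.+1 -> G).
Hypotheses (n_gt4 : (4 < n)%N) (iotaM : ghom iota).
Variables A B : 'I_n.+1 -> 'I_n.+1 -> G.
Hypotheses (Afam : refl_family iota A) (Bfam : refl_family iota B).
Hypotheses (AB_commute : commuting_families A B) (AB_exchange : exchanging_families A B).
Notation X := (shift iota A).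
Notation Y := (shift iota B).

Let card_n : (5 < #|'I_n.+1|)%N.
Proof. by rewrite card_ord. Qed.

Definition base_zed : G := zed iota A B ord0 (inord 1) (inord 2).
Notation Z := base_zed.

Lemma base_triple : uniq [:: ord0; inord 1; inord 2 : 'I_n.+1].
Proof. by rewrite /= !inE -!val_eqE /= !inordK //; lia. Qed.

Lemma gcomm_base_shift i j : gcomm (X ord0 i) (Y ord0 j) = gpow Z (base_form n i j).
Proof.
rewrite base_formE bform1_dvec !dvecE.
have [->|i0] := eqVneq i ord0.
  by rewrite shift_id !eqxx !subrr; apply/gcomm_eq1/gcommuteC/gcommute1.
have [->|j0] := eqVneq j ord0.
  by rewrite shift_id eq_sym (negPf i0) !eqxx subrr; apply/gcomm_eq1/gcommute1.
rewrite eqxx; have [->|ji] := eqVneq j i.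
  rewrite (gcomm_shift_self iotaM Afam Bfam AB_commute AB_exchange card_n base_triple) 1?eq_sym //.
  by rewrite [X in gpow Z X](_ : _ = 1 + 1) // gpow_succ gpow1.
rewrite [X in gpow Z X](_ : _ = 1) // gpow1.
by apply: (zed_const iotaM Afam Bfam AB_commute AB_exchange card_n _ base_triple); distinct.
Qed.

Definition shift_eval (h : heis n.+1) : G := heis_eval (X ord0) (Y ord0) Z h.

Lemma shift_evalM (h k : HeisGroup (1%:M : 'M_n.+1)) : balanced h -> balanced k ->
  shift_eval (h ** k) = shift_eval h ** shift_eval k.
Proof.
case: h k => a b c [a' b' c'] [/= a0 b0] [/= a0' b0'].
have XZ i : gcommute Z (X ord0 i).
  exact/gcommuteC/(zed_central_x iotaM Afam Bfam AB_commute AB_exchange card_n _ _ base_triple).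
have YZ i : gcommute Z (Y ord0 i).
  exact/gcommuteC/(zed_central_y iotaM Afam Bfam AB_commute AB_exchange card_n _ _ base_triple).
have evalM := heis_eval_hom (fun i j => shift_commute iotaM Afam ord0 i ord0 j)
  (fun i j => shift_commute iotaM Bfam ord0 i ord0 j) XZ YZ gcomm_base_shift.
rewrite /shift_eval -(evalM (Heis a b c) (Heis a' b' c')).
by congr (heis_eval _ _ _ (Heis _ _ _)); rewrite /= bform_base_form.
Qed.

Lemma shift_eval_conj (s : SymGroup 'I_n.+1) h : balanced h ->
  gconj (shift_eval h) (iota s) = shift_eval (heis_perm s h).
Proof.
case: h => a b c [/= a0 b0]; rewrite /shift_eval /heis_eval /= !gconjM.
rewrite !base_shift_conj //; congr (_ ** _ ** _).
apply/gcommute_gconjP/gcommuteC/gcommute_gpow/gcommuteC.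
exact: (zed_central_perm iotaM Afam Bfam AB_commute AB_exchange card_n s base_triple).
Qed.

Definition symheis_eval (m : SymHeis n.+1) : G := iota m.1 ** shift_eval m.2.

Lemma symheis_evalM (m m' : SymHeis n.+1) : balanced m.2 -> balanced m'.2 ->
  symheis_eval (m ** m') = symheis_eval m ** symheis_eval m'.
Proof.
apply: sd_hom_on => //; [exact: shift_evalM | exact: balanced_perm | exact: shift_eval_conj].
Qed.

Lemma symheis_eval_lift s : symheis_eval (slift s) = iota s.
Proof. by rewrite /symheis_eval /shift_eval /heis_eval !gprodz0 !gmulr1. Qed.

Lemma symheis_eval_srefl10 p q : p != q -> symheis_eval (srefl p q (1, 0)) = A p q.
Proof.
move=> pq; rewrite /symheis_eval /srefl /= mulr0 oppr0 scale1r scale0r /shift_eval.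
by rewrite heis_eval_x base_shift_dvec // -refl_shift.
Qed.

Lemma symheis_eval_srefl01 p q : p != q -> symheis_eval (srefl p q (0, 1)) = B p q.
Proof.
move=> pq; rewrite /symheis_eval /srefl /= mul0r oppr0 scale1r scale0r /shift_eval.
by rewrite heis_eval_y base_shift_dvec // -refl_shift.
Qed.

End Evaluation.

(** * The graph and its voltages *)

Definition labels : seq nat := iota 1 27.

Definition edge_of (k : nat) : nat * nat := nth (0, 0) edges k.-1.

Lemma edgP (j : 'I_27) : exists2 k, k \in labels & j = edg k.
Proof.
exists j.+1; last by rewrite /edg inord_val.
by rewrite mem_iota; have := ltn_ord j; lia.
Qed.

Lemma edg_val k : k \in labels -> edg k = k.-1 :> nat.
Proof. by rewrite mem_iota => kb; rewrite inordK //; lia. Qed.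

Lemma edg_eq k l : k \in labels -> l \in labels -> (edg k == edg l) = (k == l).
Proof.
by move=> kl ll; rewrite -val_eqE /= !edg_val //; move: kl ll; rewrite !mem_iota; lia.
Qed.

Lemma ep1_edg k : k \in labels -> ep1 (edg k) = vtx (edge_of k).1.
Proof. by move=> kl; rewrite /ep1 edg_val. Qed.

Lemma ep2_edg k : k \in labels -> ep2 (edg k) = vtx (edge_of k).2.
Proof. by move=> kl; rewrite /ep2 edg_val. Qed.

Definition is_vertex (v : nat) : bool := 0 < v <= 18.

Lemma vtx_eq a b : is_vertex a -> is_vertex b -> (vtx a == vtx b) = (a == b).
Proof. by rewrite /is_vertex => av bv; rewrite (inord_eq (n := 17)); lia. Qed.

Definition vertices : seq nat := iota 1 18.

Lemma vtxP (x : 'I_18) : exists2 v, v \in vertices & x = vtx v.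
Proof.
exists x.+1; last by rewrite /vtx inord_val.
by rewrite mem_iota; have := ltn_ord x; lia.
Qed.

Lemma vtx_uniq s : all is_vertex s -> uniq s -> uniq (map vtx s).
Proof.
move=> /allP sv us; rewrite map_inj_in_uniq // => a b /sv av /sv bv /eqP.
by rewrite vtx_eq // => /eqP.
Qed.

Lemma vtx_reach_ind (P : {perm 'I_18} -> Prop) (fixed : seq nat) r es :
  P 1%g -> (forall s t, P s -> P t -> P (s * t)%g) ->
  all [in fixed ++ reach [:: r] es] vertices ->
  (forall e, e \in es -> P (tperm (vtx e.1) (vtx e.2))) ->
  forall s : {perm 'I_18}, (forall v, v \in fixed -> s (vtx v) = vtx v) -> P s.
Proof.
move=> P1 PM /allP cover Pes s fix_s; apply: (reach_perm_ind P1 PM (f := vtx) Pes) => x.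
have [v /cover + ->] := vtxP x; rewrite mem_cat => /orP[/fix_s //|vr].
by move/negP; case; apply: map_f vr.
Qed.

Definition shares (e e' : nat * nat) : bool :=
  [|| e.1 == e'.1, e.1 == e'.2, e.2 == e'.1 | e.2 == e'.2].

Lemma edge_of_vertices k : k \in labels ->
  [&& is_vertex (edge_of k).1, is_vertex (edge_of k).2 & (edge_of k).1 != (edge_of k).2].
Proof. by move: k; apply/allP. Qed.

Lemma share_edg k l : k \in labels -> l \in labels ->
  share (edg k) (edg l) = shares (edge_of k) (edge_of l).
Proof.
move=> kl ll; have /and3P[k1 k2 _] := edge_of_vertices kl.
have /and3P[l1 l2 _] := edge_of_vertices ll.
by rewrite /share !ep1_edg // !ep2_edg // !vtx_eq.
Qed.

Definition dart : Type := (nat * nat) * (int * int).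

Definition dart_wf (r : dart) : bool :=
  [&& is_vertex r.1.1, is_vertex r.1.2 & r.1.1 != r.1.2].

Definition dart_rev (r : dart) : dart := ((r.1.2, r.1.1), (- r.2)%R).

Definition dart_eqv (r s : dart) : bool := (r == s) || (r == dart_rev s).

Definition swapn (a b c : nat) : nat := if c == a then b else if c == b then a else c.

Lemma tperm_vtx a b c : is_vertex a -> is_vertex b -> is_vertex c ->
  tperm (vtx a) (vtx b) (vtx c) = vtx (swapn a b c).
Proof.
move=> av bv cv; rewrite /swapn; have [->|ca] := eqVneq c a; first by rewrite tpermL.
have [->|cb] := eqVneq c b; first by rewrite tpermR.
by rewrite tpermD // vtx_eq // eq_sym.
Qed.

(* The displacement along each edge in the universal cover of the torus, from the
   first to the second listed endpoint.  It vanishes along the Hamiltonian path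
   [path_edges] below. *)
Definition voltages : seq (int * int) :=
  [:: (0, 0); (0, 0); (0, 0); (-1, 0); (0, 0); (0, 0); (0, 0); (0, 1); (0, 0);
      (0, 0); (0, 0); (0, 0); (1, 0); (0, 0); (-1, 1); (0, 0); (0, 0); (0, 0);
      (0, 0); (0, 0); (0, 0); (0, 0); (0, 0); (0, 1); (0, 0); (0, -1); (0, 0)]%R.

Definition dart_of (k : nat) : dart := (edge_of k, nth (0, 0)%R voltages k.-1).

Lemma dart_of_wf k : k \in labels -> dart_wf (dart_of k).
Proof. exact: edge_of_vertices. Qed.

Definition dart_shift (s : dart) (v : nat) : int * int :=
  (s.2 *+ (v == s.1.1) - s.2 *+ (v == s.1.2))%R.

(* The conjugate of the reflection along [r] by the reflection along [s]. *)
Definition slide (r s : dart) : dart :=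
  ((swapn s.1.1 s.1.2 r.1.1, swapn s.1.1 s.1.2 r.1.2),
   (r.2 + dart_shift s r.1.2 - dart_shift s r.1.1)%R).

Lemma slide_wf r s : dart_wf r -> dart_wf s -> dart_wf (slide r s).
Proof.
rewrite /dart_wf /is_vertex; case: r s => -[a b] v [[c d] w] /=; rewrite /swapn.
by case: (a =P c); case: (a =P d); case: (b =P c); case: (b =P d) => /=; lia.
Qed.

Section HexagonRelation.
Variables (G : agroup) (u : 'I_27 -> G).
Notation U k := (u (edg k)).

Definition hex_conj (h : seq nat) : Prop :=
  foldl gconj (U (head 0 h)) [seq U k | k <- take 4 (behead h)] = U (last 0 h).

Lemma hex_relE h : size h = 6 -> hex_rel u h <-> hex_conj h.
Proof.
case: h => [|a [|b [|c [|d [|e [|f []]]]]]] // _.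
by rewrite /hex_rel /hex_conj /= -!gconjMr gconjP !gmulA.
Qed.

End HexagonRelation.

(** * The reflections of the model satisfy the relations of [C] *)

Section ModelRelations.
Local Open Scope ring_scope.
Notation SH := (SymHeis 18).

Definition dart_refl (r : dart) : SH := srefl (vtx r.1.1) (vtx r.1.2) r.2.

Lemma dart_refl_eqv r s : dart_eqv r s -> dart_refl r = dart_refl s.
Proof. by case/orP=> /eqP-> //; rewrite /dart_refl -sreflC. Qed.

Lemma dart_refl_conj r s : dart_wf r -> dart_wf s ->
  gconj (dart_refl r) (dart_refl s) = dart_refl (slide r s).
Proof.
move=> /and3P[r1 r2 rn] /and3P[s1 s2 _].
rewrite /dart_refl srefl_conj ?vtx_eq // !tperm_vtx //; congr srefl.
by rewrite /sheet_shift !vtx_eq.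
Qed.

Lemma dart_refl_foldl_conj r ss : dart_wf r -> all dart_wf ss ->
  foldl gconj (dart_refl r) (map dart_refl ss) = dart_refl (foldl slide r ss).
Proof.
elim: ss r => //= s ss IH r rw /andP[sw ssw]; rewrite dart_refl_conj // IH //.
exact: slide_wf.
Qed.

Definition sgen (j : 'I_27) : SH := srefl (ep1 j) (ep2 j) (nth 0 voltages j).

Lemma sgen_edg k : k \in labels -> sgen (edg k) = dart_refl (dart_of k).
Proof. by move=> kl; rewrite /sgen ep1_edg // ep2_edg // edg_val. Qed.

Lemma sgen_sq j : sgen j ** sgen j = gone.
Proof.
have [k kl ->] := edgP j; have /and3P[k1 k2 kn] := edge_of_vertices kl.
by rewrite sgen_edg //; apply: srefl_sq; rewrite vtx_eq.
Qed.

Lemma sgen_conj k l : k \in labels -> l \in labels ->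
  gconj (sgen (edg k)) (sgen (edg l)) = dart_refl (slide (dart_of k) (dart_of l)).
Proof.
move=> kl ll; rewrite (sgen_edg kl) (sgen_edg ll).
by apply: dart_refl_conj; apply: dart_of_wf.
Qed.

Lemma sgen_commute i j : ~~ share i j -> gcommute (sgen i) (sgen j).
Proof.
have [[k kl ->] [l ll ->]] := (edgP i, edgP j); rewrite share_edg // => kl_far.
apply/gcommute_gconjP; rewrite (sgen_conj kl ll) (sgen_edg kl); apply: dart_refl_eqv.
have /allP/(_ k kl)/allP/(_ l ll)/implyP-> // : all (fun k => all (fun l =>
    ~~ shares (edge_of k) (edge_of l) ==> dart_eqv (slide (dart_of k) (dart_of l)) (dart_of k))
  labels) labels by vm_compute.
Qed.

Lemma sgen_braid i j : i != j -> share i j -> braid (sgen i) (sgen j).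
Proof.
have [[k kl ->] [l ll ->]] := (edgP i, edgP j); rewrite share_edg // edg_eq // => kn kl_near.
apply/(braid_involutionP (sgen_sq _) (sgen_sq _)).
rewrite (sgen_conj kl ll) (sgen_conj ll kl); apply: dart_refl_eqv.
have /allP/(_ k kl)/allP/(_ l ll)/implyP-> // : all (fun k => all (fun l =>
    (k != l) && shares (edge_of k) (edge_of l) ==>
    dart_eqv (slide (dart_of k) (dart_of l)) (slide (dart_of l) (dart_of k)))
  labels) labels by vm_compute.
by rewrite kn.
Qed.

Lemma sgen_hexagon h : h \in hexagons -> hex_rel sgen h.
Proof.
move=> hh; have /allP/(_ h hh) : all (fun h => [&& size h == 6, all [in labels] h &
    dart_eqv (foldl slide (dart_of (head 0 h)) (map dart_of (take 4 (behead h))))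
            (dart_of (last 0 h))]) hexagons by vm_compute.
case/and3P=> /eqP h6 hl /dart_refl_eqv hE; apply/hex_relE => //.
case: h h6 hl hE {hh} => [|a [|b [|c [|d [|e [|f []]]]]]] // _.
case/and5P=> al bl cl dl /and3P[el fl _]; rewrite -dart_refl_foldl_conj.
- by rewrite /hex_conj /= !sgen_edg //.
- exact: dart_of_wf.
- by rewrite /= !dart_of_wf.
Qed.

Lemma sgen_CRel : CRel sgen.
Proof.
split=> [j|i j|i j|h]; [exact: sgen_sq | exact: sgen_commute | exact: sgen_braid |].
exact: sgen_hexagon.
Qed.

(* Along [T0] the voltages are the increments of this function, so that one element
   of the Heisenberg group conjugates the reflections indexed by [T0] into plain
   transpositions. *)
Definition potential (v : nat) : int :=
  if v \in [:: 1; 2; 3; 4; 5; 6; 8; 14; 16]%N then -1 else 0.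

Definition gauge : SH := sheis (heisg 0 (\row_i potential i.+1) 0).

Definition T0_labels : seq nat :=
  [:: 5; 6; 8; 9; 11; 12; 14; 16; 18; 19; 20; 21; 22; 24; 25; 26; 27]%N.

Lemma sgen_T0 j : j \in T0 -> sgen j = gconj (slift (tperm (ep1 j) (ep2 j))) gauge.
Proof.
case/mapP=> k kT ->; have /allP/(_ k kT)/andP[kl /eqP kv] : all (fun k => (k \in labels) &&
    ((dart_of k).2 == (0, potential (edge_of k).2 - potential (edge_of k).1))) T0_labels.
  by vm_compute.
have /and3P[v1 v2 _] := edge_of_vertices kl; rewrite slift_tperm_conj sgen_edg //.
rewrite ep1_edg // ep2_edg // /dart_refl kv !mxE subrr /vtx !inordK ?prednK //.
all: by move: v1 v2; rewrite /is_vertex; lia.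
Qed.

End ModelRelations.

(** * Consequences of the relations of [C] *)

(* A Hamiltonian path: its edges generate a copy of the symmetric group by the
   Coxeter relations alone. *)
Definition path_vertices : seq nat :=
  [:: 3; 2; 7; 11; 12; 10; 18; 17; 9; 4; 6; 14; 16; 8; 5; 1; 13; 15].
Definition path_edges : seq nat :=
  [:: 6; 1; 14; 21; 19; 20; 27; 18; 3; 9; 12; 25; 16; 11; 5; 2; 22].

Lemma path_edge_label k : k \in path_edges -> k \in labels.
Proof. by move: k; apply/allP. Qed.

Lemma path_vertices_inj : injective (fun i : 'I_18 => vtx (nth 0 path_vertices i)).
Proof.
have pv : all is_vertex path_vertices by [].
move=> i j /eqP; rewrite vtx_eq ?(all_nthP 0 pv) // nth_uniq // => /eqP; exact: val_inj.
Qed.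

Definition path_perm : {perm 'I_18} := perm path_vertices_inj.

Lemma path_permE i : i < 18 -> path_perm (inord i) = vtx (nth 0 path_vertices i).
Proof. by move=> i18; rewrite permE inordK. Qed.

Lemma path_edgesE i : i < 17 ->
  let e := (nth 0 path_vertices i, nth 0 path_vertices i.+1) in
  edge_of (nth 0 path_edges i) \in [:: e; (e.2, e.1)].
Proof.
move=> i17; have /allP : all (fun i =>
    let e := (nth 0 path_vertices i, nth 0 path_vertices i.+1) in
    edge_of (nth 0 path_edges i) \in [:: e; (e.2, e.1)]) (iota 0 17) by [].
by apply; rewrite mem_iota.
Qed.

Lemma hexagon_rotation (G : agroup) (a b w f : G) :
  a ** a = gone -> b ** b = gone -> braid a b -> gcommute a w ->
  gconj (gconj a b) w = f -> gconj (gconj b w) f = a.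
Proof.
move=> aa bb /(braid_involutionP aa bb) ab /gcommute_gconjP aw <-.
rewrite -gconjJ -[in RHS]aw; congr gconj.
by rewrite ab -[X in gconj X _]gconj1r -aa gconjMr -gconjJ -ab -(gconjMr a) bb gconj1r gconj_id.
Qed.

Section Relations.
Variables (G : agroup) (u : 'I_27 -> G).
Hypothesis uC : CRel u.
Notation U k := (u (edg k)).

Lemma U_sq k : U k ** U k = gone.
Proof. by case: uC. Qed.

Lemma U_commute k l : k \in labels -> l \in labels -> ~~ shares (edge_of k) (edge_of l) ->
  gcommute (U k) (U l).
Proof. by case: uC => _ cm _ _ kl ll far; apply: cm; rewrite share_edg. Qed.

Lemma U_braid k l : k \in labels -> l \in labels -> k != l -> shares (edge_of k) (edge_of l) ->
  braid (U k) (U l).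
Proof. by case: uC => _ _ br _ kl ll kn near; apply: br; rewrite ?edg_eq ?share_edg. Qed.

Definition rotatable (h : seq nat) : bool :=
  if h is [:: a; b; c; d; e; f] then
    [&& all [in labels] h, (a != b) && shares (edge_of a) (edge_of b) &
        all (fun k => ~~ shares (edge_of a) (edge_of k)) [:: c; d; e]]
  else false.

Lemma hex_conj_rot h : rotatable h -> hex_conj u h -> hex_conj u (rot 1 h).
Proof.
case: h => [|a [|b [|c [|d [|e [|f []]]]]]] //.
case/and3P=> /and5P[al bl cl dl /andP[el _]] /andP[ab near] /and4P[ac ad ae _].
rewrite /hex_conj /= -!(gconjMr (gconj (U a) (U b))) -!(gconjMr (U b)) (gconjMr (U b)).
apply: hexagon_rotation; rewrite ?U_sq //; first exact: U_braid.
by do 2?apply: gcommuteM; apply: U_commute.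
Qed.

Lemma hexagon_conj h n : h \in hexagons -> n < 6 -> hex_conj u (rot n h).
Proof.
move=> hh; have /allP/(_ h hh)/andP[/eqP h6 /allP rot_h] : all (fun h => (size h == 6) &&
    all (fun n => rotatable (rot n h)) (iota 0 6)) hexagons by [].
elim: n => [_|n IH n6]; first by rewrite rot0; apply/hex_relE => //; case: uC => _ _ _; apply.
rewrite rotS ?h6 1?ltnW //; apply: hex_conj_rot (IH (ltnW n6)).
by apply: rot_h; rewrite mem_iota; lia.
Qed.

Lemma hexagon_commute h k : hex_conj u h -> size h = 6 ->
  (forall l, l \in drop 2 h -> gcommute (U k) (U l)) ->
  gcommute (U k) (gconj (U (nth 0 h 0)) (U (nth 0 h 1))).
Proof.
case: h => [|a [|b [|c [|d [|e [|f []]]]]]] //; rewrite /hex_conj /=.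
rewrite -!(gconjMr (gconj (U a) (U b))) => hE _ kl.
apply: (@gconj_inj _ _ _ (U c ** U d ** U e)); rewrite gconjM [in RHS]gconjM hE.
have /gcommute_gconjP-> : gcommute (U k) (U c ** U d ** U e).
  by do 2?apply: gcommuteM; apply: kl; rewrite !inE eqxx ?orbT.
by apply: kl; rewrite !inE eqxx !orbT.
Qed.

Lemma path_edges_coxeter : coxeter 17 (fun i => U (nth 0 path_edges i)).
Proof.
have pl i : i < 17 -> nth 0 path_edges i \in labels.
  by move=> i17; apply: path_edge_label; rewrite mem_nth.
split=> [i _|i j ij j17|i i17]; first exact: U_sq.
  have i17 : i < 17 by lia.
  apply: U_commute; rewrite ?pl //; have /allP/(_ i)/[!mem_iota]/(_ i17)/allP/(_ j) :
    all (fun i => all (fun j => (i.+1 < j) ==> ~~ shares (edge_of (nth 0 path_edges i))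
      (edge_of (nth 0 path_edges j))) (iota 0 17)) (iota 0 17) by [].
  by rewrite mem_iota ij; apply.
have /allP/(_ i) : all (fun i => (nth 0 path_edges i != nth 0 path_edges i.+1) &&
    shares (edge_of (nth 0 path_edges i)) (edge_of (nth 0 path_edges i.+1))) (iota 0 16) by [].
by rewrite mem_iota => /(_ i17)/andP[ii near]; apply: U_braid; rewrite ?pl // ltnW.
Qed.

Lemma path_hom : exists2 io : SymGroup 'I_18 -> G, ghom io &
  forall k, k \in path_edges -> U k = tau io (vtx (edge_of k).1) (vtx (edge_of k).2).
Proof.
have [io ioM io_adj] := coxeter_path_hom path_perm path_edges_coxeter.
exists io => // k kp; have i17 : index k path_edges < 17 by rewrite -index_mem in kp.
have := io_adj _ i17; rewrite !path_permE ?nth_index //; try lia.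
have := path_edgesE i17; rewrite /= nth_index // !inE => /orP[] /eqP-> <- //.
exact: tauC.
Qed.

End Relations.

Section Reconstruction.
Variables (G : agroup) (u : 'I_27 -> G).
Hypothesis uC : CRel u.
Notation U k := (u (edg k)).
Variable io : SymGroup 'I_18 -> G.
Hypothesis ioM : ghom io.
Hypothesis U_path : forall k, k \in path_edges ->
  U k = tau io (vtx (edge_of k).1) (vtx (edge_of k).2).
Notation t a b := (tau io (vtx a) (vtx b)).

Lemma tau_tau a b c d : all is_vertex [:: a; b; c; d] ->
  gconj (t a b) (t c d) = t (swapn c d a) (swapn c d b).
Proof. by case/and5P=> av bv cv dv _; rewrite tau_conj // !tperm_vtx. Qed.

Definition far_edges (w : nat) : seq (nat * nat) :=
  [seq edge_of k | k <- path_edges & ~~ shares (edge_of w) (edge_of k)].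

(* The path falls apart when the endpoints of [w] are removed; the transposition
   of [e] joins the pieces. *)
Definition joins_path (w : nat) (e : nat * nat) (r : nat) : bool :=
  all [in [:: (edge_of w).1; (edge_of w).2] ++ reach [:: r] (far_edges w ++ e :: far_edges w)]
    vertices.

Lemma U_commute_stabilizer w e r : w \in labels -> joins_path w e r ->
  gcommute (U w) (t e.1 e.2) ->
  forall s : SymGroup 'I_18, s (vtx (edge_of w).1) = vtx (edge_of w).1 ->
    s (vtx (edge_of w).2) = vtx (edge_of w).2 -> gcommute (U w) (io s).
Proof.
move=> wl cover we s s1 s2; pose P (s : {perm 'I_18}) := gcommute (U w) (io s).
have P1 : P 1%g by rewrite /P (ghom1 ioM : io 1%g = gone); apply: gcommute1.
have PM s' s'' : P s' -> P s'' -> P (s' * s'')%g.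
  by move=> Ps' Ps''; rewrite /P (ioM s' s'' : io (s' * s'')%g = _); apply: gcommuteM.
have Pfar e' : e' \in far_edges w -> P (tperm (vtx e'.1) (vtx e'.2)).
  case/mapP=> k; rewrite mem_filter => /andP[far kp] ->.
  rewrite /P -[io _]/(tau io _ _) -U_path //; exact: U_commute (path_edge_label kp) far.
apply: (vtx_reach_ind P1 PM cover) => [e'|v].
  by rewrite mem_cat inE => /or3P[/Pfar //|/eqP-> //|/Pfar].
by rewrite !inE => /orP[]/eqP->.
Qed.

Definition path_neighbour (w v r k : nat) : bool :=
  [&& k \in path_edges, w != k, edge_of k \in [:: (v, r); (r, v)], is_vertex r &
      r \notin [:: (edge_of w).1; (edge_of w).2]].

Lemma path_neighbour_uniq w v r k : w \in labels -> path_neighbour w v r k ->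
  uniq [:: vtx (edge_of w).1; vtx (edge_of w).2; vtx r].
Proof.
move=> wl /and5P[_ _ _ rv rw]; have /and3P[w1 w2 wn] := edge_of_vertices wl.
by apply: (@vtx_uniq [:: _; _; r]); [rewrite /= w1 w2 rv | distinct].
Qed.

Lemma path_neighbour_braid w v r k : w \in labels -> path_neighbour w v r k ->
  v \in [:: (edge_of w).1; (edge_of w).2] -> braid (U w) (t v r).
Proof.
move=> wl /and5P[kp wk ek _ _] vw.
have <- : U k = t v r.
  by rewrite U_path //; move: ek; rewrite !inE => /orP[]/eqP->; rewrite // tauC.
apply: U_braid (path_edge_label kp) wk _ => //; move: ek vw.
by rewrite /shares !inE => /orP[]/eqP-> /orP[]/eqP->; rewrite !eqxx ?orbT.
Qed.

Definition family_at (w : nat) (A : 'I_18 -> 'I_18 -> G) : Prop :=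
  refl_family io A /\ A (vtx (edge_of w).1) (vtx (edge_of w).2) = U w.

Lemma family_at_exists w e r r1 r2 k1 k2 : w \in labels -> joins_path w e r ->
  gcommute (U w) (t e.1 e.2) -> path_neighbour w (edge_of w).2 r1 k1 ->
  path_neighbour w (edge_of w).1 r2 k2 -> exists A, family_at w A.
Proof.
move=> wl cover we nb1 nb2; have stab := U_commute_stabilizer wl cover we.
have /and3P[w1 w2 wn] := edge_of_vertices wl.
have {}wn : vtx (edge_of w).1 != vtx (edge_of w).2 by rewrite vtx_eq.
exists (orbit_family io (U w) (vtx (edge_of w).1) (vtx (edge_of w).2)).
split; last exact: orbit_family0.
apply: (orbit_refl_family ioM wn stab (r1 := vtx r1) (r2 := vtx r2)).
- exact: path_neighbour_uniq nb1.
- exact: path_neighbour_uniq nb2.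
- exact: U_sq.
- by apply: (path_neighbour_braid wl nb1); rewrite !inE eqxx orbT.
- by apply: (path_neighbour_braid wl nb2); rewrite !inE eqxx.
Qed.

(* The hexagon at the inner endpoint of edge 13 shows that [u_13] commutes with the
   transposition of the two neighbours of this endpoint on the path; similarly for
   edge 8. *)
Lemma family_at13 : exists A, family_at 13 A.
Proof.
apply: (@family_at_exists 13 (2, 11) 3 13 2 22 1) => //.
have hE := hexagon_conj uC (h := [:: 1; 7; 9; 3; 17; 14]) (n := 5) isT isT.
have := hexagon_commute (k := 13) hE erefl.
rewrite /= (U_path (k := 14)) // (U_path (k := 1)) // tau_tau // tauC; apply=> l.
by rewrite !inE => /or4P[] /eqP->; apply: (U_commute uC).
Qed.

Lemma family_at8 : exists B, family_at 8 B.
Proof.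
apply: (@family_at_exists 8 (12, 18) 2 12 2 19 6) => //.
have hE := hexagon_conj uC (h := [:: 21; 17; 18; 27; 20; 19]) (n := 4) isT isT.
have := hexagon_commute (k := 8) hE erefl.
rewrite /= (U_path (k := 20)) // (U_path (k := 19)) // tau_tau //; apply=> l.
by rewrite !inE => /or4P[] /eqP->; apply: (U_commute uC).
Qed.

Section WithFamilies.
Variables A B : 'I_18 -> 'I_18 -> G.
Hypotheses (Afam : refl_family io A) (Bfam : refl_family io B).

Definition unit_voltages : seq (int * int) := [:: (1, 0); (-1, 0); (0, 1); (0, -1)]%R.

Definition volt_family (v : int * int) (p q : 'I_18) : G :=
  if v == 0%R then tau io p q else if v == (1, 0)%R then A p q
  else if v == (-1, 0)%R then A q p else if v == (0, 1)%R then B p q else B q p.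

Lemma volt_family0 p q : volt_family 0%R p q = tau io p q.
Proof. by rewrite /volt_family eqxx. Qed.

Lemma volt_family_conj v p q s : p != q ->
  gconj (volt_family v p q) (io s) = volt_family v (s p) (s q).
Proof.
move=> pq; have [[AJ _ _ _] [BJ _ _ _]] := (Afam, Bfam).
by rewrite /volt_family; do !case: ifP => _; rewrite ?tau_conj ?AJ ?BJ // eq_sym.
Qed.

Lemma volt_familyC v p q : v \in 0%R :: unit_voltages ->
  volt_family (- v)%R p q = volt_family v q p.
Proof.
by rewrite !inE => /or4P[/eqP->|/eqP->|/eqP->|/orP[]/eqP->] //; rewrite /volt_family /= tauC.
Qed.

Lemma tau_volt_family v p q r : v \in unit_voltages -> uniq [:: p; q; r] ->
  gconj (tau io p q) (volt_family v q r) = volt_family v p r.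
Proof.
move=> vu pqr; have u1 : uniq [:: q; r; p] by distinct.
have u2 : uniq [:: r; q; p] by distinct.
have [[_ Ar] [_ Br]] := (tau_conj_refl ioM Afam u1, tau_conj_refl ioM Bfam u1).
have [[Al _] [Bl _]] := (tau_conj_refl ioM Afam u2, tau_conj_refl ioM Bfam u2).
by rewrite tauC; move: vu; rewrite !inE => /or4P[]/eqP->.
Qed.

Definition dart_elt (r : dart) : G := volt_family r.2 (vtx r.1.1) (vtx r.1.2).

Lemma dart_elt_eqv r s : s.2 \in 0%R :: unit_voltages -> dart_eqv r s -> dart_elt r = dart_elt s.
Proof. by move=> su /orP[]/eqP-> //; rewrite /dart_elt volt_familyC. Qed.

(* Conjugating by a transposition only permutes the endpoints, and a transposition
   conjugated by an adjacent member of a family is another member of it. *)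
Definition slidable (r s : dart) : bool :=
  [&& dart_wf r, dart_wf s & (s.2 == 0%R) ||
    [&& r.2 == 0%R, s.2 \in unit_voltages, shares r.1 s.1,
        r.1 != s.1 & r.1 != (s.1.2, s.1.1)]].

Lemma dart_elt_slide r s : slidable r s -> gconj (dart_elt r) (dart_elt s) = dart_elt (slide r s).
Proof.
case: r s => -[a b] v [[c d] w]; rewrite /slidable /dart_wf /=.
case/and3P=> /and3P[av bv ab] /and3P[cv dv cd]; have abv : vtx a != vtx b by rewrite vtx_eq.
case/orP=> [/eqP->|/and5P[/eqP-> wu near n1 n2]].
  rewrite /slide /dart_shift /= !mul0rn !subr0 /dart_elt /= -!tperm_vtx //.
  by rewrite -volt_family_conj // volt_family0.
have wu0 : w \in 0%R :: unit_voltages by rewrite inE wu orbT.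
have wuN : (- w)%R \in unit_voltages by move: wu; rewrite !inE => /or4P[]/eqP->.
have flip p q : volt_family w p q = volt_family (- w)%R q p by rewrite volt_familyC.
have adjacent x y z w' : w' \in unit_voltages -> is_vertex x -> is_vertex y -> is_vertex z ->
    uniq [:: x; y; z] -> gconj (t x y) (volt_family w' (vtx y) (vtx z))
      = volt_family w' (vtx x) (vtx z).
  by move=> w'u xv yv zv xyz; apply: tau_volt_family => //; apply: (@vtx_uniq [:: x; y; z]);
     rewrite //= xv yv zv.
rewrite /dart_elt /= volt_family0 /slide /dart_shift /swapn /=; move: near n1 n2.
rewrite /shares /= !xpair_eqE; case/or4P=> /eqP e; [subst c|subst d|subst c|subst d];
  rewrite !eqxx /= ?andbT.
- rewrite (eq_sym b a) (negPf ab) (negPf cd) => bd _.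
  rewrite (negPf bd) !mulr1n !mulr0n !subr0 ?add0r ?sub0r volt_familyC // tauC.
  by apply: adjacent => //; distinct.
- rewrite (eq_sym b a) (negPf ab) eq_sym (negPf cd) => _ bc.
  rewrite (negPf bc) !mulr1n !mulr0n ?subr0 ?sub0r opprK ?add0r tauC.
  by rewrite (flip (vtx c)) [RHS]flip; apply: adjacent => //; distinct.
- rewrite (negPf ab) (negPf cd) andbF => _ ad.
  rewrite (negPf ad) !mulr1n !mulr0n !subr0 add0r.
  by apply: adjacent => //; distinct.
- rewrite (negPf ab) (eq_sym b c) (negPf cd) andbF => ac _.
  rewrite (negPf ac) !mulr1n !mulr0n !subr0 ?add0r ?sub0r.
  by rewrite flip; apply: adjacent => //; distinct.
Qed.

Fixpoint slidable_along (r : dart) (ss : seq dart) : bool :=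
  if ss is s :: ss' then slidable r s && slidable_along (slide r s) ss' else true.

Lemma dart_elt_foldl_slide r ss : slidable_along r ss ->
  foldl gconj (dart_elt r) (map dart_elt ss) = dart_elt (foldl slide r ss).
Proof. by elim: ss r => //= s ss IH r /andP[rs ss_ok]; rewrite dart_elt_slide ?IH. Qed.

Definition known (k : nat) : Prop := U k = dart_elt (dart_of k).

Definition determines_last (h : seq nat) : bool :=
  let r := dart_of (head 0 h) in let ss := map dart_of (take 4 (behead h)) in
  let f := dart_of (last 0 h) in
  [&& slidable_along r ss, f.2 \in 0%R :: unit_voltages & dart_eqv (foldl slide r ss) f].

Lemma hexagon_known h : hex_conj u h -> determines_last h ->
  (forall k, k \in head 0 h :: take 4 (behead h) -> known k) -> known (last 0 h).
Proof.
move=> hE /and3P[ok fu fE] kn; rewrite /known -(dart_elt_eqv fu fE) -dart_elt_foldl_slide //.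
rewrite -hE (kn (head 0 h)) ?mem_head // -map_comp; congr foldl.
by apply/eq_in_map => k kin; apply: kn; rewrite inE kin orbT.
Qed.

Fixpoint derivable (seen : seq nat) (hs : seq (seq nat)) : bool :=
  if hs is h :: hs' then
    [&& determines_last h, all [in seen] (head 0 h :: take 4 (behead h)) &
        derivable (last 0 h :: seen) hs']
  else true.

Lemma derivable_known seen hs : derivable seen hs -> (forall h, h \in hs -> hex_conj u h) ->
  (forall k, k \in seen -> known k) -> forall k, k \in seen ++ map (last 0) hs -> known k.
Proof.
elim: hs seen => [|h hs IH] seen; first by rewrite cats0.
case/and3P=> det /allP sub der hsE kn k kin.
apply: (IH (last 0 h :: seen)) => // [h' h'in|l|].
- by apply: hsE; rewrite inE h'in orbT.
- rewrite inE => /orP[/eqP->|/kn //]; apply: hexagon_known det _.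
    by apply: hsE; rewrite mem_head.
  by move=> l' /sub/kn.
- by move: kin; rewrite !mem_cat !inE orbCA orbA.
Qed.

Hypotheses (A13 : A (vtx 7) (vtx 15) = U 13) (B8 : B (vtx 3) (vtx 10) = U 8).

Definition solved_hexagons : seq (seq nat) :=
  [:: rot 5 [:: 12; 25; 16; 11; 10; 9]; rot 2 [:: 21; 17; 18; 27; 20; 19];
      rot 2 [:: 1; 7; 9; 3; 17; 14]; rot 5 [:: 3; 10; 5; 2; 23; 18];
      rot 2 [:: 2; 4; 6; 1; 13; 22]; rot 3 [:: 8; 20; 24; 12; 7; 6];
      rot 4 [:: 27; 23; 22; 26; 25; 24]].

Lemma U_known k : k \in labels -> k != 15 -> known k.
Proof.
move=> kl k15; apply: (@derivable_known (13 :: 8 :: path_edges) solved_hexagons) => //.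
- by move=> h; rewrite !inE => /or4P[/eqP->|/eqP->|/eqP->|/or4P[]/eqP->]; apply: (hexagon_conj uC).
- move=> l; rewrite 2!in_cons => /or3P[/eqP->|/eqP->|lp] //.
  have /allP/(_ l lp)/eqP l0 : all (fun l => (dart_of l).2 == 0%R) path_edges by [].
  by rewrite /known /dart_elt l0 volt_family0; apply: U_path.
- have /allP/(_ k kl)/implyP : all (fun k => (k != 15) ==>
    (k \in (13 :: 8 :: path_edges) ++ map (last 0) solved_hexagons)) labels by [].
  exact.
Qed.

Lemma dart_elt_conj_slide r s w : slidable r w -> slidable s w ->
  gconj (gconj (dart_elt r) (dart_elt s)) (dart_elt w)
  = gconj (dart_elt (slide r w)) (dart_elt (slide s w)).
Proof. by move=> rw sw; rewrite gconjJ (dart_elt_slide rw) (dart_elt_slide sw). Qed.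

Lemma U15_hexagon4 : U 15 = gconj (B (vtx 3) (vtx 12)) (A (vtx 3) (vtx 8)).
Proof.
have := hexagon_conj uC (h := [:: 11; 15; 19; 8; 4; 5]) (n := 2) isT isT.
rewrite /hex_conj /= => <-; rewrite (U_known (k := 19)) // (U_known (k := 8)) //.
rewrite (U_known (k := 4)) // (U_known (k := 5)) // (U_known (k := 11)) //.
by rewrite dart_elt_slide // !dart_elt_conj_slide.
Qed.

Lemma U15_hexagon7 : U 15 = gconj (B (vtx 8) (vtx 15)) (A (vtx 12) (vtx 15)).
Proof.
have := hexagon_conj uC (h := [:: 26; 13; 14; 21; 15; 16]) (n := 5) isT isT.
rewrite /hex_conj /= => <-; rewrite (U_known (k := 16)) // (U_known (k := 26)) //.
rewrite (U_known (k := 13)) // (U_known (k := 14)) // (U_known (k := 21)) //.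
by rewrite dart_elt_slide // !dart_elt_conj_slide.
Qed.

Lemma families_commute : commuting_families A B.
Proof.
move=> p q r s us; have u0 : uniq (map vtx [:: 7; 15; 3; 10]) by apply: vtx_uniq.
have [f [<- <- <- <-]] := perm_map_exists u0 us erefl.
have [[AJ _ _ _] [BJ _ _ _]] := (Afam, Bfam); rewrite -AJ ?vtx_eq // -BJ ?vtx_eq //.
by apply: gcommute_gconj; rewrite A13 B8; apply: (U_commute uC).
Qed.

Lemma families_exchange : exchanging_families A B.
Proof.
move=> p q r s us; have u0 : uniq (map vtx [:: 3; 8; 12; 15]) by apply: vtx_uniq.
have [f [<- <- <- <-]] := perm_map_exists u0 us erefl.
have [[AJ _ _ _] [BJ _ _ _]] := (Afam, Bfam).
by rewrite -!AJ ?vtx_eq // -!BJ ?vtx_eq // -!gconjJ -U15_hexagon4 -U15_hexagon7.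
Qed.

Notation eval := (symheis_eval io A B).

Lemma eval_conj (m m' : SymHeis 18) : m' ** m' = gone -> balanced m.2 -> balanced m'.2 ->
  eval (gconj m m') = gconj (eval m) (eval m').
Proof.
move=> mm' bm bm'.
have evalM := symheis_evalM (n := 17) isT ioM Afam Bfam families_commute families_exchange.
have eval1 : eval gone = gone by rewrite (symheis_eval_lift io A B gone) (ghom1 ioM).
rewrite !gconj_involution //; last by rewrite -evalM // mm'.
by rewrite !evalM //; apply: balancedM.
Qed.

Lemma eval_dart r : dart_wf r -> r.2 \in 0%R :: unit_voltages -> eval (dart_refl r) = dart_elt r.
Proof.
case: r => -[a b] v /and3P[av bv ab] vu; have abv : vtx a != vtx b by rewrite vtx_eq.
have bav : vtx b != vtx a by rewrite eq_sym.
move: vu; rewrite !inE /dart_refl /dart_elt /= => /or4P[/eqP->|/eqP->|/eqP->|/orP[]/eqP->].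
- by rewrite srefl0 symheis_eval_lift volt_family0.
- by rewrite symheis_eval_srefl10.
- by rewrite sreflC symheis_eval_srefl10.
- by rewrite symheis_eval_srefl01.
- by rewrite sreflC symheis_eval_srefl01.
Qed.

Lemma eval_sgen j : eval (sgen j) = u j.
Proof.
have [k kl ->] := edgP j; rewrite sgen_edg //; have [->|k15] := eqVneq k 15.
  have -> : dart_refl (dart_of 15)
      = gconj (dart_refl (3, 12, (0, 1)%R)) (dart_refl (3, 8, (1, 0)%R)).
    by rewrite dart_refl_conj.
  rewrite eval_conj; try exact: balanced_srefl; last by apply: srefl_sq; rewrite vtx_eq.
  by rewrite !eval_dart // U15_hexagon4.
rewrite (U_known kl k15); apply: eval_dart; first exact: dart_of_wf.
have /allP/(_ k kl)/implyP : all (fun k => (k != 15) ==>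
  ((dart_of k).2 \in 0%R :: unit_voltages)) labels by [].
exact.
Qed.

End WithFamilies.
End Reconstruction.

Lemma symheis_retraction (G : agroup) (u : 'I_27 -> G) : CRel u ->
  exists eval : SymHeis 18 -> G,
    (forall m m' : SymHeis 18, balanced m.2 -> balanced m'.2 ->
      eval (m ** m') = eval m ** eval m') /\
    (forall j, eval (sgen j) = u j).
Proof.
move=> uC; have [io ioM U_path] := path_hom uC.
have [A [Afam A13]] := family_at13 uC ioM U_path.
have [B [Bfam B8]] := family_at8 uC ioM U_path.
exists (symheis_eval io A B); split=> [m m'|j].
  exact: symheis_evalM (families_commute uC Afam Bfam A13 B8)
    (families_exchange uC ioM U_path Afam Bfam A13 B8) _ _.
exact: eval_sgen.
Qed.

(** * The group [C] inside the model *)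

Lemma sgen_generate (P : SymHeis 18 -> Prop) : subgroup P -> (forall j, P (sgen j)) ->
  forall m : SymHeis 18, balanced m.2 -> P m.
Proof.
move=> sP Pg; have [P1 PM _] := subgroup_preimage (@slift_hom 18) sP.
have Ppath e : e \in map edge_of path_edges -> P (slift (tperm (vtx e.1) (vtx e.2))).
  case/mapP=> k kp ->; have := Pg (edg k); rewrite sgen_edg ?path_edge_label //.
  have /allP/(_ k kp)/eqP k0 : all (fun k => (dart_of k).2 == 0%R) path_edges by [].
  by rewrite /dart_refl k0 srefl0.
have Ps s : P (slift s).
  have cover : all [in [::] ++ reach [:: 3] (map edge_of path_edges)] vertices by vm_compute.
  by apply: (vtx_reach_ind P1 PM cover Ppath) => v; rewrite in_nil.
have Prefl p0 q0 v p q : p0 != q0 -> p != q -> P (srefl p0 q0 v) -> P (srefl p q v).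
  move=> pq0 pq Pv; have [||//|s [<- <-]] := @perm_map_exists _ [:: p0; q0] [:: p; q].
  - by rewrite /= inE pq0.
  - by rewrite /= inE pq.
  by rewrite -srefl_slift_conj //; apply: subgroup_gconj.
apply: balanced_min => // p q pq.
  apply: (@Prefl (vtx 7) (vtx 15)); rewrite ?vtx_eq //.
  by have := Pg (edg 13); rewrite sgen_edg.
apply: (@Prefl (vtx 3) (vtx 10)); rewrite ?vtx_eq //.
by have := Pg (edg 8); rewrite sgen_edg.
Qed.

Lemma CRel_hom (G K : agroup) (u : 'I_27 -> G) (f : G -> K) :
  ghom f -> CRel u -> CRel (fun j => f (u j)).
Proof.
move=> fM [sq cm br hx]; split=> [j|i j far|i j ij near|h hin].
- by rewrite -fM sq ghom1.
- by rewrite -!fM cm.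
- by rewrite -!fM br.
- by rewrite /hex_rel -!fM hx.
Qed.

Lemma presentsC_eq (C K : agroup) (u : 'I_27 -> C) (f g : C -> K) :
  presentsC u -> ghom f -> ghom g -> (forall j, f (u j) = g (u j)) -> forall c, f c = g c.
Proof.
move=> [uC uni] fM gM fg c; have [h [_ h_uniq]] := uni K _ (CRel_hom fM uC).
have hf : h = f by apply: h_uniq; split.
have hg : h = g by apply: h_uniq; split.
by rewrite -hf hg.
Qed.

Lemma HRel_hom (H K : agroup) (x y : 'I_18 -> H) (z : H) (f : H -> K) :
  ghom f -> central (f z) -> HRel x y z -> HRel (fun i => f (x i)) (fun i => f (y i)) (f z).
Proof.
move=> fM fz [xy xyz _]; split=> // [i j ij|i]; last by rewrite -(ghom_gcomm fM) xyz.
by have [xx yy xy'] := xy _ _ ij; split; rewrite -(ghom_gcomm fM) ?xx ?yy ?xy' ghom1.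
Qed.

Lemma presentsH_eq (H K : agroup) (x y : 'I_18 -> H) (z : H) (f g : H -> K) :
  presentsH x y z -> ghom f -> ghom g -> central (f z) ->
  (forall i, f (x i) = g (x i)) -> (forall i, f (y i) = g (y i)) -> f z = g z ->
  forall h, f h = g h.
Proof.
move=> [xyz uni] fM gM fz fx fy fgz h; have [k [_ k_uniq]] := uni K _ _ _ (HRel_hom fM fz xyz).
have kf : k = f by apply: k_uniq; split.
have kg : k = g by apply: k_uniq; split.
by rewrite -kf kg.
Qed.

Theorem presentsC_symheis (C : agroup) (u : 'I_27 -> C) : presentsC u ->
  exists f : C -> SymHeis 18,
    [/\ ghom f, forall j, f (u j) = sgen j, injective f, forall c, balanced (f c).2 &
        forall m : SymHeis 18, balanced m.2 -> exists c, f c = m].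
Proof.
move=> HC; have [uC uni] := HC; have [f [[fM fu] _]] := uni _ _ sgen_CRel.
have zero (p : SymHeis 18 -> ZmodGroup int) : ghom p -> (forall j, p (sgen j) = 0%R) ->
    forall c, p (f c) = 0%R.
  move=> pM pg; apply: (presentsC_eq HC (ghom_comp pM fM)) => [a b|j]; last by rewrite fu.
  by rewrite /gmul /= addr0.
have fb c : balanced (f c).2.
  by split; [apply: (zero _ (@coord_sum_x_hom 18)) | apply: (zero _ (@coord_sum_y_hom 18))] => j;
     have [] := balanced_srefl (ep1 j) (ep2 j) (nth 0%R voltages j).
have [eval [evalM eval_sgen]] := symheis_retraction uC.
have fK : cancel f eval.
  apply: (presentsC_eq (f := fun c => eval (f c)) (g := id) HC) => // [a b|j].
    by rewrite fM evalM.
  by rewrite fu.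
exists f; split=> //; first exact: can_inj fK.
by apply: sgen_generate (subgroup_range fM) _ => j; exists (u j).
Qed.

(** * The group [H] as the Heisenberg group *)

Lemma heis_HRel : HRel (fun i => heisg (delta_mx 0 i) 0 0)%R (fun i => heisg 0 (delta_mx 0 i) 0)%R
  (heisg 0 0 1 : HeisGroup (1%:M : 'M[int]_18))%R.
Proof.
split=> [i j ij|i|]; last exact: heis_z_central; last first.
  by rewrite heis_gcomm_xy bform_delta mxE eqxx.
split; last by rewrite heis_gcomm_xy bform_delta mxE (negPf ij).
  by apply/gcomm_eq1; rewrite /gcommute -!heis_x_hom /gmul /= addrC.
by apply/gcomm_eq1; rewrite /gcommute -!heis_y_hom /gmul /= addrC.
Qed.

Theorem presentsH_heis (H : agroup) (x y : 'I_18 -> H) (z : H) : presentsH x y z ->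
  exists F : H -> HeisGroup (1%:M : 'M[int]_18), exists N,
    [/\ ghom F, cancel F N, cancel N F &
        [/\ forall i, F (x i) = heisg (delta_mx 0 i)%R 0%R 0%R,
            forall i, F (y i) = heisg 0%R (delta_mx 0 i)%R 0%R & F z = heisg 0%R 0%R 1%R]].
Proof.
move=> HH; have [[xy xyz zc] uni] := HH.
have [F [[FM Fx Fy Fz] _]] := uni _ _ _ _ heis_HRel.
have xx i j : gcommute (x i) (x j).
  by have [->//|ij] := eqVneq i j; have [/gcomm_eq1] := xy _ _ ij.
have yy i j : gcommute (y i) (y j).
  by have [->//|ij] := eqVneq i j; have [_ /gcomm_eq1] := xy _ _ ij.
have xyB i j : gcomm (x i) (y j) = gpow z ((1%:M : 'M[int]_18)%R i j).
  rewrite mxE; have [->|ij] := eqVneq i j; first by rewrite gpow1.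
  by have [_ _] := xy _ _ ij.
have NM := heis_eval_hom xx yy (fun i => zc _) (fun i => zc _) xyB.
exists F, (heis_eval x y z); split=> // [h|[a b c]].
  apply: (presentsH_eq (g := id) HH (ghom_comp NM FM)) h => // [|i|i|].
  - by rewrite Fz heis_eval_z.
  - by rewrite Fx heis_eval_x gprodz_delta.
  - by rewrite Fy heis_eval_y gprodz_delta.
  - by rewrite Fz heis_eval_z.
have Fxa : F (gprodz x a) = heisg a 0%R 0%R.
  move: a; apply: ghom_rV_eq (ghom_comp FM (gprodz_hom xx)) (@heis_x_hom _ _) _ => i.
  by rewrite gprodz_delta.
have Fyb : F (gprodz y b) = heisg 0%R b 0%R.
  move: b; apply: ghom_rV_eq (ghom_comp FM (gprodz_hom yy)) (@heis_y_hom _ _) _ => i.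
  by rewrite gprodz_delta.
rewrite /heis_eval /= !FM Fxa Fyb (ghom_gpow _ _ FM) Fz heis_z_gpow.
by rewrite -heisg_xyz.
Qed.

Section SpanningTree.
Variables (C : agroup) (u : 'I_27 -> C) (psi : C -> PermGroup).
Hypotheses (psi_hom : ghom psi) (psi_u : forall j, psi (u j) = tperm (ep1 j) (ep2 j)).

Definition T0_subgroup : C -> Prop := gen_sub (fun c => exists2 j, j \in T0 & c = u j).

Definition T0_walk : seq nat := [:: 5; 11; 16; 25; 24; 20; 8; 6; 19; 21; 14; 12; 9; 26; 22; 27; 18].

Lemma psi_T0_surj s : exists a, T0_subgroup a /\ psi a = s.
Proof.
pose P s := exists a, T0_subgroup a /\ psi a = s; rewrite -/(P s).
have [P1 PM _] : subgroup P := subgroup_image psi_hom (subgroup_gen_sub _).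
have Pe e : e \in map edge_of T0_walk -> P (tperm (vtx e.1) (vtx e.2)).
  case/mapP=> k kT ->; have /allP/(_ k kT)/andP[kT0 kl] :
    all (fun k => (k \in T0_labels) && (k \in labels)) T0_walk by [].
  exists (u (edg k)); split; last by rewrite psi_u ep1_edg ?ep2_edg.
  by apply: gen_in; exists (edg k) => //; apply: map_f.
have cover : all [in [::] ++ reach [:: 1] (map edge_of T0_walk)] vertices by vm_compute.
by apply: (vtx_reach_ind P1 PM cover Pe) => v; rewrite in_nil.
Qed.

Variable f : C -> SymHeis 18.
Hypotheses (fM : ghom f) (fu : forall j, f (u j) = sgen j) (f_inj : injective f).

Lemma T0_subgroup_gauge a : T0_subgroup a -> f a = gconj (slift (psi a)) gauge.
Proof.
apply: (gen_sub_min (P := fun a => f a = gconj (slift (psi a)) gauge)) => [|_ [j jT ->]].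
  apply: subgroup_equalizer => // b c.
  by rewrite psi_hom slift_hom gconjM.
by rewrite fu psi_u sgen_T0.
Qed.

Lemma psi_T0_inj a b : T0_subgroup a -> T0_subgroup b -> psi a = psi b -> a = b.
Proof.
by move=> /T0_subgroup_gauge fa /T0_subgroup_gauge fb ab; apply: f_inj; rewrite fa fb ab.
Qed.

End SpanningTree.

Section Kernel.
Variables (C : agroup) (psi : C -> PermGroup) (f : C -> SymHeis 18).
Hypotheses (fM : ghom f) (f_inj : injective f) (psiE : forall c, (f c).1 = psi c).
Hypotheses (f_balanced : forall c, balanced (f c).2)
  (f_surj : forall m : SymHeis 18, balanced m.2 -> exists c, f c = m).

Definition kernel_coords (c : C) : Z34 := heis_coords (f c).2.

Lemma kernel_coordsM a b : gker psi b ->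
  kernel_coords (a ** b) = kernel_coords a ** kernel_coords b.
Proof.
move=> pb; rewrite /kernel_coords fM symheisM /= psiE pb heis_perm1.
exact: (@heis_coords_hom 17 (f a).2 (f b).2).
Qed.

Lemma kernel_coords_surj v : exists2 a, gker psi a & kernel_coords a = v.
Proof.
have [h bh hv] := @heis_coords_surj 17 v; have [c fc] := f_surj (m := sheis h) bh.
by exists c; rewrite /gker -?psiE /kernel_coords fc.
Qed.

Variable zC : C.
Hypothesis f_zC : f zC = sheis (heisg 0 0 1)%R.

Lemma f_gpow_zC n : f (gpow zC n) = sheis (heisg 0 0 n)%R.
Proof. by rewrite (ghom_gpow _ _ fM) f_zC -(ghom_gpow _ _ (@sheis_hom _)) heis_z_gpow. Qed.

Lemma gpow_zC_eq1 n : gpow zC n = gone -> n = 0%R.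
Proof. by move=> /(congr1 f); rewrite f_gpow_zC (ghom1 fM) => -[]. Qed.

Lemma central_gpow_zC c : central c <-> exists n, c = gpow zC n.
Proof.
split=> [cc|[n ->] d]; last first.
  by apply: f_inj; rewrite !fM f_gpow_zC sheis_z_central.
have [s|n fc] := @symheis_central_eq 17 isT _ (f_balanced c).
  have [|d fd] := f_surj (m := slift s); first by split; rewrite /= raddf0.
  by rewrite -fd /gcommute -!fM cc.
by exists n; apply: f_inj; rewrite f_gpow_zC.
Qed.

Lemma kernel_coords_eq1 a : gker psi a -> kernel_coords a = gone <-> exists n, a = gpow zC n.
Proof.
move=> pa; have fa : f a = sheis (f a).2.
  by rewrite [LHS]symheisE psiE pa (ghom1 (@slift_hom _)) gmul1.
have coords_a := @heis_coords_eq1 17 (f a).2 (f_balanced a).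
split=> [/coords_a[n e]|[n e]]; [exists n | apply/coords_a; exists n].
  by apply: f_inj; rewrite fa e f_gpow_zC.
by rewrite e f_gpow_zC.
Qed.

Variables (H : agroup) (ab : H -> Z2) (act : {perm 'I_18} -> H -> H).
Variables (F : H -> HeisGroup (1%:M : 'M[int]_18)%R) (N : HeisGroup (1%:M : 'M[int]_18)%R -> H).
Hypotheses (FM : ghom F) (FK : cancel F N) (NK : cancel N F).
Hypothesis F_act : forall s h, F (act s h) = heis_perm s (F h).
Hypothesis ab_eq0P : forall h, ab h = 0%R <-> balanced (F h).

Definition heis_part (c : C) : H := N (f c).2.

Lemma model_heis_part c : F (heis_part c) = (f c).2.
Proof. exact: NK. Qed.

Lemma ab_heis_part c : ab (heis_part c) = 0%R.
Proof. by apply/ab_eq0P; rewrite model_heis_part. Qed.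

Lemma heis_partM c d : heis_part (c ** d) = act (psi d) (heis_part c) ** heis_part d.
Proof.
apply: (can_inj FK); rewrite FM F_act !model_heis_part fM -psiE.
by [].
Qed.

Lemma heis_part_inj c d : psi c = psi d -> heis_part c = heis_part d -> c = d.
Proof.
move=> pcd /(congr1 F); rewrite !model_heis_part => fcd; apply: f_inj.
by rewrite [LHS]symheisE [RHS]symheisE !psiE pcd fcd.
Qed.

Lemma heis_part_surj s k : ab k = 0%R -> exists c, psi c = s /\ heis_part c = k.
Proof.
move=> /ab_eq0P bk; have [c fc] := f_surj (m := (s, F k)) bk.
by exists c; rewrite -psiE /heis_part fc FK.
Qed.

Lemma heis_part_bij s k : ab k = 0%R -> exists! c, psi c = s /\ heis_part c = k.
Proof.
move=> /(heis_part_surj s)[c [pc fc]]; exists c; split=> // d [pd fd].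
by apply: heis_part_inj; rewrite ?pc ?fc.
Qed.

Lemma heis_part_kernel_iso : iso_on heis_part (gker psi) (gker ab).
Proof.
split=> [a b pa pb|a _|a b pa pb|h ah]; [|exact: ab_heis_part | |].
- rewrite heis_partM pb; congr (_ ** _); apply: (can_inj FK).
  by rewrite F_act; apply: heis_perm1.
- by apply: heis_part_inj; rewrite pa.
- by have [c [pc fc]] := heis_part_surj gone ah; exists c.
Qed.

End Kernel.

Lemma presentsC_psi (C : agroup) (u : 'I_27 -> C) (psi : C -> PermGroup) (f : C -> SymHeis 18) :
  presentsC u -> ghom psi -> (forall j, psi (u j) = tperm (ep1 j) (ep2 j)) ->
  ghom f -> (forall j, f (u j) = sgen j) -> forall c, (f c).1 = psi c.
Proof.
move=> HC psi_hom psi_u fM fu.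
apply: (presentsC_eq (K := PermGroup) (f := fun c => (f c).1) HC) => // [a b|j].
  by rewrite fM.
by rewrite fu psi_u.
Qed.

Section HeisenbergAction.
Variables (H : agroup) (x y : 'I_18 -> H) (z : H) (F : H -> HeisGroup (1%:M : 'M[int]_18)%R).
Hypotheses (HH : presentsH x y z) (FM : ghom F).
Hypothesis Fx : forall i, F (x i) = (heisg (delta_mx 0 i) 0 0)%R.
Hypothesis Fy : forall i, F (y i) = (heisg 0 (delta_mx 0 i) 0)%R.
Hypothesis Fz : F z = (heisg 0 0 1)%R.

Lemma presentsH_act (act : {perm 'I_18} -> H -> H) : (forall s, ghom (act s)) ->
  (forall s i, act s (x i) = x (s i)) -> (forall s i, act s (y i) = y (s i)) ->
  (forall s, act s z = z) -> forall s h, F (act s h) = heis_perm s (F h).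
Proof.
move=> act_hom act_x act_y act_z s.
apply: (presentsH_eq (f := fun h => F (act s h)) (g := fun h => heis_perm s (F h)) HH).
- exact: ghom_comp FM (act_hom s).
- exact: ghom_comp (@heis_perm_hom _ s) FM.
- by rewrite act_z Fz; apply: heis_z_central.
- by move=> i; rewrite act_x !Fx /heis_perm /= delta_perm !mul0mx.
- by move=> i; rewrite act_y !Fy /heis_perm /= delta_perm !mul0mx.
- by rewrite act_z Fz /heis_perm /= !mul0mx.
Qed.

Section Abelianization.
Variable ab : H -> Z2.
Hypotheses (ab_hom : ghom ab) (ab_x : forall i, ab (x i) = xZ) (ab_y : forall i, ab (y i) = yZ).
Hypothesis ab_z : ab z = 0%R.

Lemma presentsH_ab h : ab h = (coord_sum (hx (F h)) *: xZ + coord_sum (hy (F h)) *: yZ)%R.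
Proof.
move: h; apply: (presentsH_eq HH ab_hom) => [a b|b|i|i|].
- by rewrite FM /= !raddfD /= !scalerDl [RHS]addrACA.
- by rewrite /gmul /= addrC.
- by rewrite ab_x Fx /= coord_sum_delta raddf0 scale1r scale0r addr0.
- by rewrite ab_y Fy /= coord_sum_delta raddf0 scale1r scale0r add0r.
- by rewrite ab_z Fz /= !raddf0 !scale0r addr0.
Qed.

Lemma presentsH_ab_eq0 h : ab h = 0%R <-> balanced (F h).
Proof.
rewrite presentsH_ab; split=> [/rowP e|[-> ->]]; last by rewrite !scale0r addr0.
have := e ord0; have := e (inord 1); rewrite !mxE /= -!val_eqE /= inordK //=.
by rewrite !mulr1 !mulr0 addr0 add0r => y0 x0; split.
Qed.

End Abelianization.
End HeisenbergAction.

Theorem theorem1p1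
  (C : agroup) (u : 'I_27 -> C) (HC : presentsC u)
  (psi : C -> PermGroup) (psi_hom : ghom psi)
  (psi_u : forall j, psi (u j) = tperm (ep1 j) (ep2 j))
  (H : agroup) (x y : 'I_18 -> H) (z : H) (HH : presentsH x y z)
  (ab : H -> Z2) (ab_hom : ghom ab)
  (ab_x : forall i, ab (x i) = xZ) (ab_y : forall i, ab (y i) = yZ)
  (ab_z : ab z = 0%R)
  (act : {perm 'I_18} -> H -> H) (act_hom : forall s, ghom (act s))
  (act_x : forall s i, act s (x i) = x (s i))
  (act_y : forall s i, act s (y i) = y (s i))
  (act_z : forall s, act s z = z) :
  (* (i) *)
  ((forall s : PermGroup, exists c, psi c = s) /\
   (let L := gen_sub (fun c : C => exists2 j, j \in T0 & c = u j) in
    [/\ (forall a b, L a -> L b -> psi a = psi b -> a = b),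
        (forall s : PermGroup, exists a, L a /\ psi a = s) &
        (forall c : C, exists! kl : C * C,
            [/\ gker psi kl.1, L kl.2 & c = kl.1 ** kl.2])])) /\
  (* (ii) *)
  (exists f : C -> H, iso_on f (gker psi) (gker ab)) /\
  (exists phi : C -> H,
     [/\ (forall c, ab (phi c) = 0%R),
         (forall c d, phi (c ** d) = act (psi d) (phi c) ** phi d),
         (forall (s : PermGroup) (k : H), ab k = 0%R ->
             exists! c, psi c = s /\ phi c = k) &
  (* (iii) *)
         (exists zC : C,
            [/\ psi zC = gone, phi zC = z,
                (forall n, gpow zC n = gone -> n = 0%R),
                (forall c, central c <-> exists n, c = gpow zC n) &
                (exists q : C -> Z34,
                   [/\ (forall a b, gker psi a -> gker psi b -> q (a ** b) = q a ** q b),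
                       (forall v : Z34, exists2 a, gker psi a & q a = v) &
                       (forall a, gker psi a -> (q a = gone <-> exists n, a = gpow zC n))])])]).
Proof.
have [f [fM fu f_inj f_balanced f_surj]] := presentsC_symheis HC.
have [F [N [FM FK NK [Fx Fy Fz]]]] := presentsH_heis HH.
have psiE := presentsC_psi HC psi_hom psi_u fM fu.
have F_act := presentsH_act HH FM Fx Fy Fz act_hom act_x act_y act_z.
have ab_eq0 := presentsH_ab_eq0 HH FM Fx Fy Fz ab_hom ab_x ab_y ab_z.
have L_inj := psi_T0_inj psi_hom psi_u fM fu f_inj.
have L_surj := psi_T0_surj psi_hom psi_u.
have [|zC f_zC] := f_surj (sheis (heisg 0 0 1)%R); first by split; rewrite /= raddf0.
split; [split=> [s|] | split].
- by have [a [_ <-]] := L_surj s; exists a.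
- by split=> //; apply: unique_factorization.
- by exists (heis_part f N); apply: heis_part_kernel_iso.
exists (heis_part f N); split=> [c|c d|s k|].
- exact: ab_heis_part.
- exact: (heis_partM fM psiE FM FK NK F_act).
- exact: (heis_part_bij f_inj psiE f_surj FK NK ab_eq0).
exists zC; split; [by rewrite -psiE f_zC | by rewrite /heis_part f_zC -Fz FK | | |].
- exact: gpow_zC_eq1.
- exact: central_gpow_zC.
exists (kernel_coords f); split=> [a b _|v|a].
- exact: kernel_coordsM.
- exact: kernel_coords_surj.
- exact: kernel_coords_eq1.
Qed.
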